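(* Let $n\ge2$ and $K=\mathbb{R}$ or $\mathbb{C}$. (a) If $A\in M_n^*(K)$ is a positive definite Hermitian matrix, then the network $(T,F_{A,T})$ is positive for every tiling $T$ of $P_n$. (b) Conversely, if $(T,F)$ is a generic positive network with values in $K$ and $F(v_0)=1$, then the matrix $A\in M_n^*(K)$ with $F_{A,T}=F$ is positive definite Hermitian.
   Context: $[n]=\{1,\dots,n\}$; $A_X^Y$ is the submatrix of $A$ with rows $X$ and columns $Y$ in increasing order; the empty determinant is 1. An almost-principal minor $\det A_{S\cup\{i\}}^{S\cup\{j\}}$ ($i\neq j$, $i,j\notin S$) is odd if $(i-j)(-1)^{|S|}>0$. $M_n^*(K)$ is the set of $n\times n$ matrices over $K$ all of whose principal minors and odd almost-principal minors are nonzero. Tilings: let $e_j=e^{\pi i(j-1)/n}\in\mathbb{R}^2$, and let $P_n$ be the regular $2n$-gon with unit edges which is the convex hull of $\{\sum_{j\in S}e_j:S\subseteq[n]\}$; $v_0=0$. A tiling $T$ of $P_n$ is a tiling by translates of the unit rhombi $R_{jk}$ ($j<k$) with edges parallel to $e_j,e_k$, each occurring exactly once. Each vertex $v$ of $T$ corresponds to the subset $S\subseteq[n]$ of those $j$ such that $e_j$ is a step of a shortest path along tiling edges from $v_0$ to $v$. Put $\sigma(v)=(-1)^{\lfloor |S|/2\rfloor}$. $U(T)$ is the set of vertices and rhombi of $T$; the rhombus with vertex subsets $S,S\cup\{i\},S\cup\{j\},S\cup\{i,j\}$ is denoted $\langle S;i,j\rangle$. A network is a pair $(T,F)$, $F:U(T)\to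 K$. For a matrix $A$, $F_{A,T}(v)=\sigma(v)\det A_S^S$ for a vertex $v$ corresponding to $S$, and $F_{A,T}(\langle S;i,j\rangle)$ is $(-1)^{\lfloor(|S|+1)/2\rfloor}$ times the odd one among $\det A_{S\cup\{j\}}^{S\cup\{i\}}$, $\det A_{S\cup\{i\}}^{S\cup\{j\}}$. Cube moves: three tiles of $T$ forming a hexagon span a Boolean interval $[S,S\cup\{p,q,r\}]$, $p<q<r$; the center vertex is $S\cup\{q\}$ (with faces $\langle S;p,q\rangle,\langle S;q,r\rangle,\langle S\cup\{q\};p,r\rangle$) or $S\cup\{p,r\}$ (with faces $\langle S;p,r\rangle,\langle S\cup\{r\};p,q\rangle,\langle S\cup\{p\};q,r\rangle$). A cube move replaces one configuration by the other; the values at the center and three faces are replaced so that the hexahedron relation holds, all other values unchanged. Here the values are named (writing $Sq=S\cup\{q\}$, etc.) $a_8=F(S)$, $a_4=F(Sp)$, $a_0=F(Sq)$, $a_6=F(Sr)$, $a_9=F(Spq)$, $a_0^*=F(Spr)$, $a_7=F(Sqr)$, $a_5=F(Spqr)$, $a_1=F(\langle S;p,q\rangle)$, $a_3=F(\langle S;q,r\rangle)$, $a_2=F(\langle Sq;p,r\rangle)$, $a_2^*=F(\langle S;p,r\rangle)$, $a_1^*=F(\langle Sr;p,q\rangle)$, $a_3^*=F(\langle Sp;q,r\rangle)$, and the hexahedron relation is $$a_1^*a_1a_0=a_1a_2a_3+a_7a_8a_9+a_0a_4a_7,\quad a_2^*a_2a_0=a_1a_2a_3+a_7a_8a_9+a_0a_5a_8,\quad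 a_3^*a_3a_0=a_1a_2a_3+a_7a_8a_9+a_0a_6a_9,$$ $$a_0^*a_0^2a_1a_2a_3=(a_1a_2a_3)^2+a_1a_2a_3(2a_7a_8a_9+a_0a_4a_7+a_0a_5a_8+a_0a_6a_9)+(a_8a_9+a_0a_4)(a_9a_7+a_0a_5)(a_7a_8+a_0a_6).$$ Two networks are equivalent if related by a finite sequence of cube moves and multiplications of all values by a nonzero constant. A network is generic if it and all equivalent networks have only nonzero values. For every generic network $(T,F)$ with $F(v_0)=1$ there is a unique $A\in M_n^*(K)$ with $F_{A,T}=F$. A network is Hermitian if $F(v)$ is real for all vertices and, for each face $f$ with vertices $a,b,c,d$ in cyclic order, $|F(f)|^2=F(a)F(c)+F(b)F(d)$. A Hermitian network is positive if, for all vertices $v$, the sign of $F(v)$ is $\sigma(v)$. *)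

(* Defs.v *)
From Stdlib Require Import Relations.
From HB Require Import structures.
From mathcomp Require Import all_boot all_order all_algebra.
From mathcomp Require Import boolp reals trigo complex.

Set Implicit Arguments.
Unset Strict Implicit.
Unset Printing Implicit Defensive.
Import Order.TTheory GRing.Theory Num.Theory.
Local Open Scope ring_scope.

(* [n] is 'I_n = {0,..,n-1}: all indices are shifted down by one. *)

Section Minors.
Variables (K : numFieldType) (n : nat).
Implicit Types (A : 'M[K]_n) (S X Y : {set 'I_n}).

(* det A_X^Y, meant for #|X| = #|Y|; enum lists a set of ordinals in
   increasing order, and the default value of nth is then never used. *)
Definition minor A X Y : K :=
  \det (\matrix_(a < #|X|, b < #|X|)
          A (enum_val a) (nth (enum_val a) (enum Y) b)).

(* Oddness of the almost-principal minor with rows i |: S and columns j |: S. *)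
Definition odd_apm S (i j : 'I_n) : bool :=
  0 < ((i : nat)%:Z - (j : nat)%:Z) * (-1) ^+ #|S|.

Definition Mstar A : Prop :=
  (forall S, minor A S S != 0) /\
  (forall S i j, i != j -> i \notin S -> j \notin S -> odd_apm S i j ->
     minor A (i |: S) (j |: S) != 0).

Definition posdef_hermitian (conj : K -> K) A : Prop :=
  map_mx conj A^T = A /\
  (forall x : 'cV[K]_n, x != 0 -> 0 < (map_mx conj x^T *m A *m x) ord0 ord0).

End Minors.

(* K is R with trivial conjugation, or C = R[i] with complex conjugation. *)
Inductive real_or_complex (R : realType) :
    forall K : numFieldType, (K -> K) -> Prop :=
| IsReal : @real_or_complex R R id
| IsComplex : @real_or_complex R R[i] (@conjc R).

Definition plane (R : realType) := (R^o * R^o)%type.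

Section Tilings.
Variables (R : realType) (n : nat).
Implicit Types (x u v t : plane R) (j k : 'I_n).

Definition e j : plane R :=
  (cos (pi * (j : nat)%:R / n%:R), sin (pi * (j : nat)%:R / n%:R)).

(* P_n, the convex hull of the subset sums of the e j. *)
Definition polygon x : Prop :=
  exists w : {set 'I_n} -> R,
    [/\ forall S, 0 <= w S,
        \sum_(S : {set 'I_n}) w S = 1 &
        x = \sum_(S : {set 'I_n}) w S *: \sum_(j in S) e j].

(* The translate t + R_jk of the unit rhombus, and its interior. *)
Definition rhombus j k t x : Prop :=
  exists a b : R, [/\ 0 <= a <= 1, 0 <= b <= 1 & x = t + a *: e j + b *: e k].

Definition rhombus_int j k t x : Prop :=
  exists a b : R, [/\ 0 < a < 1, 0 < b < 1 & x = t + a *: e j + b *: e k].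

(* Each R_jk (j < k) occurs exactly once, translated by pos j k; the values
   pos j k for k <= j are never used. *)
Record tiling := Tiling {
  pos : 'I_n -> 'I_n -> plane R;
  tiling_cover : forall x,
    polygon x <-> exists j k, (j < k)%N /\ rhombus j k (pos j k) x;
  tiling_disjoint : forall j k j' k' x, (j < k)%N -> (j' < k')%N ->
    rhombus_int j k (pos j k) x -> rhombus_int j' k' (pos j' k') x ->
    j = j' /\ k = k'
}.

Section Graph.
Variable T : tiling.

Definition vertex v : Prop :=
  exists j k, (j < k)%N /\
    let t := pos T j k in
    [\/ v = t, v = t + e j, v = t + e k | v = t + e j + e k].

(* u to u + e i is a side of some tile of T *)
Definition tiling_edge u i : Prop :=
  exists j k, (j < k)%N /\
    let t := pos T j k in
    (i = j /\ (u = t \/ u = t + e k)) \/ (i = k /\ (u = t \/ u = t + e j)).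

(* The step (i, true) is + e i and the step (i, false) is - e i. *)
Fixpoint walk u (s : seq ('I_n * bool)) v : Prop :=
  match s with
  | [::] => u = v
  | (i, true) :: s' => tiling_edge u i /\ walk (u + e i) s' v
  | (i, false) :: s' => tiling_edge (u - e i) i /\ walk (u - e i) s' v
  end.

Definition shortest_walk u s v : Prop :=
  walk u s v /\ forall s', walk u s' v -> (size s <= size s')%N.

Definition label v : {set 'I_n} :=
  [set i | `[< exists s, shortest_walk 0 s v /\ (i, true) \in s >]].

End Graph.
End Tilings.

Section Networks.
Variables (R : realType) (n : nat) (K : numFieldType).

Definition sigma (S : {set 'I_n}) : K := (-1) ^+ (#|S|./2).

(* Only the values of fvert at vertices of T and of fface at pairs j < k
   (the rhombus of T that is a translate of R_jk) are meaningful. *)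
Record network := Network {
  net_tiling : tiling R n;
  fvert : plane R -> K;
  fface : 'I_n -> 'I_n -> K
}.

Definition same_values (N N' : network) : Prop :=
  (forall v, vertex (net_tiling N) v -> fvert N v = fvert N' v) /\
  (forall j k : 'I_n, (j < k)%N -> fface N j k = fface N' j k).

(* (T, F_{A,T}); the rhombus with lowest corner t = pos T j k is
   <label T t; j, k>. *)
Definition minor_network (A : 'M[K]_n) (T : tiling R n) : network :=
  Network T
    (fun v => let S := label T v in sigma S * minor A S S)
    (fun j k => let S := label T (pos T j k) in
       (-1) ^+ (#|S|.+1./2) *
       (if odd_apm S j k then minor A (j |: S) (k |: S)
        else minor A (k |: S) (j |: S))).

Definition hexahedron (a0 a1 a2 a3 a4 a5 a6 a7 a8 a9 b0 b1 b2 b3 : K) : Prop :=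
  [/\ b1 * a1 * a0 = a1 * a2 * a3 + a7 * a8 * a9 + a0 * a4 * a7,
      b2 * a2 * a0 = a1 * a2 * a3 + a7 * a8 * a9 + a0 * a5 * a8,
      b3 * a3 * a0 = a1 * a2 * a3 + a7 * a8 * a9 + a0 * a6 * a9 &
      b0 * a0 ^+ 2 * (a1 * a2 * a3) =
        (a1 * a2 * a3) ^+ 2
        + a1 * a2 * a3 * (2 * (a7 * a8 * a9) + a0 * a4 * a7 + a0 * a5 * a8
                          + a0 * a6 * a9)
        + (a8 * a9 + a0 * a4) * (a9 * a7 + a0 * a5) * (a7 * a8 + a0 * a6)].

(* N has the hexagon with lowest corner x, directions p < q < r and center
   x + e q; N' has the same hexagon with center x + e p + e r. The center and
   the three faces are named a0..a3 in N and b0..b3 in N'.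
   When a0..a3 are nonzero the first relation determines b0..b3. In the other
   direction it does not determine a0..a3 from b0..b3: it holds for arbitrary
   b0..b3 as soon as a0 = 0 and a1 a2 a3 + a7 a8 a9 = 0. The second relation is
   the first one for the cube seen from its opposite vertex (exchanging
   a_i and b_i for i < 4, and a4, a5, a6 and a7, a8, a9). It follows from the
   first when a0..a3 are nonzero, and it implies the first and determines
   a0..a3 when b0..b3 are nonzero; it excludes those spurious solutions. *)
Definition hexagon_flip (N N' : network) : Prop :=
  let T := net_tiling N in let T' := net_tiling N' in
  let e := @e R n in
  exists (x : plane R) (p q r : 'I_n), (p < q < r)%N /\
  [/\ pos T p q = x, pos T q r = x & pos T p r = x + e q] /\
  [/\ pos T' p r = x, pos T' p q = x + e r & pos T' q r = x + e p] /\
  (forall j k : 'I_n, (j < k)%N -> (j, k) \notin [:: (p, q); (q, r); (p, r)] ->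
     pos T' j k = pos T j k /\ fface N' j k = fface N j k) /\
  (forall v, vertex T v -> v <> x + e q -> fvert N' v = fvert N v) /\
  let a8 := fvert N x in
  let a4 := fvert N (x + e p) in
  let a0 := fvert N (x + e q) in
  let a6 := fvert N (x + e r) in
  let a9 := fvert N (x + e p + e q) in
  let b0 := fvert N' (x + e p + e r) in
  let a7 := fvert N (x + e q + e r) in
  let a5 := fvert N (x + e p + e q + e r) in
  let a1 := fface N p q in
  let a3 := fface N q r in
  let a2 := fface N p r in
  let b2 := fface N' p r in
  let b1 := fface N' p q in
  let b3 := fface N' q r in
  hexahedron a0 a1 a2 a3 a4 a5 a6 a7 a8 a9 b0 b1 b2 b3 /\
  hexahedron b0 b1 b2 b3 a7 a8 a9 a4 a5 a6 a0 a1 a2 a3.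

Definition cube_move (N N' : network) : Prop :=
  hexagon_flip N N' \/ hexagon_flip N' N.

Definition rescaling (N N' : network) : Prop :=
  (forall j k : 'I_n, (j < k)%N ->
     pos (net_tiling N') j k = pos (net_tiling N) j k) /\
  exists2 c : K, c != 0 &
    (forall v, vertex (net_tiling N) v -> fvert N' v = c * fvert N v) /\
    (forall j k : 'I_n, (j < k)%N -> fface N' j k = c * fface N j k).

Definition equivalent : relation network :=
  clos_refl_trans network (fun N N' => cube_move N N' \/ rescaling N N').

Definition nonzero_values (N : network) : Prop :=
  (forall v, vertex (net_tiling N) v -> fvert N v != 0) /\
  (forall j k : 'I_n, (j < k)%N -> fface N j k != 0).

Definition net_generic (N : network) : Prop :=
  forall N', equivalent N N' -> nonzero_values N'.

Definition net_hermitian (N : network) : Prop :=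
  (forall v, vertex (net_tiling N) v -> fvert N v \is Num.real) /\
  (forall j k : 'I_n, (j < k)%N ->
     let t := pos (net_tiling N) j k in
     `|fface N j k| ^+ 2 =
       fvert N t * fvert N (t + e R j + e R k)
       + fvert N (t + e R j) * fvert N (t + e R k)).

Definition net_positive (N : network) : Prop :=
  net_hermitian N /\
  (forall v, vertex (net_tiling N) v ->
     Num.sg (fvert N v) = sigma (label (net_tiling N) v)).

End Networks.

(* Main.v *)
Require Import Defs.
From mathcomp Require Import all_boot all_order all_algebra all_fingroup.
From mathcomp Require Import boolp reals trigo complex.
From mathcomp Require Import ring lra zify.
Set Implicit Arguments.
Unset Strict Implicit.
Unset Printing Implicit Defensive.
Import Order.TTheory GRing.Theory Num.Theory.
Local Open Scope ring_scope.

(** The face <S; j, k> of a network gives one of the two almost-principal minors at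
    [S], [j], [k]. By Sylvester's identity ([minor_sylvester]) the product of the two
    is the right-hand side of the Hermitian condition, up to the signs sigma. So the
    condition holds at a face if and only if the two minors are conjugate to each other,
    provided that the one in the network is nonzero and the principal minors are real.

    This gives the first part at once, as soon as the corners of a tile are known to
    carry the labels [S], [j |: S], [k |: S], [j |: (k |: S)]. For the second part, all
    minors are expressed by the Schur complements of the blocks [S] ([minor_schur]), so
    that a face says that two symmetric entries of a Schur complement are conjugate, and
    that some principal minors are positive. This information goes through a cube move
    ([hermitian_cube]): the three faces around the old center give those around the new
    one by a linear argument. Every tiling can be brought by cube moves to the one whose
    labels are intervals ([sweep_faces]), and there the faces give one entry of the
    matrix after the other, moving away from the diagonal, and the leading principal
    minors ([hermitian_intervals]). Sylvester's criterion ends the proof.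

    Cube moves are not performed on tilings of the plane but on a combinatorial
    shadow. For each direction [q], the tiles with sides [e q] form a strip, which
    meets each other strip once. All that is kept is the order of these tiles along each
    strip; it determines the labels of all tiles ([label_order]). The condition on
    such orders is that the label of a tile can be read off either of its two strips. An
    inverted triangle of strips that no other strip meets can be turned over, and as long
    as some triangle is inverted there is such an empty one ([exists_empty_triangle]).

    The shape of a tiling is derived from its definition by looking at points infinitely
    close to a given one, encoded as germs of curves. A germ in the polygon lies in some
    tile, and a germ lies in the inside of at most one. It follows that sides match
    exactly ([edge_match]): only sides of the polygon have tiles on one side only.
    Turning around a vertex from tile to tile then shows that every vertex but the lowest
    can be left downwards ([down_edge]), and that two ways down are joined by tiles
    ([diamond]). By Newman's argument all upward walks from the origin to a vertex use the
    same directions, each once, and these form the label of the vertex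
    ([label_upwalk]). *)

(** * Determinants and minors *)

Section Determinants.
Variable K : comNzRingType.

(** Both are the determinant of the block matrix with rows [1, V] and [- U, 1],
    which has a lower-upper and an upper-lower triangular factorisation. *)
Lemma det_1_mulmx m n (U : 'M[K]_(n, m)) (V : 'M[K]_(m, n)) :
  \det (1%:M + U *m V) = \det (1%:M + V *m U).
Proof.
have -> : \det (1%:M + U *m V) = \det (block_mx 1%:M V (- U) 1%:M).
  have -> : block_mx 1%:M V (- U) 1%:M =
      block_mx 1%:M 0 (- U) 1%:M *m block_mx 1%:M V 0 (1%:M + U *m V).
    rewrite mulmx_block !mul1mx !mul0mx ?mulmx0 !mulmx1 !addr0 mulNmx.
    by rewrite (addrC 1%:M) addrA addNr add0r.
  by rewrite det_mulmx det_lblock det_ublock !det1 !mul1r.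
have -> : block_mx 1%:M V (- U) 1%:M =
    block_mx (1%:M + V *m U) V 0 1%:M *m block_mx 1%:M 0 (- U) 1%:M.
  rewrite mulmx_block !mul0mx !mulmx0 !mulmx1 !add0r mul1mx mulmxN addrK //.
by rewrite det_mulmx det_lblock det_ublock !det1 !mulr1.
Qed.

Lemma det_replace_row n (k : 'I_n) (v : 'rV[K]_n) :
  \det (\matrix_(i, j) (if i == k then v 0 j else (i == j)%:R)) = v 0 k.
Proof.
pose U : 'M[K]_(n, 1) := delta_mx k 0.
pose V : 'M[K]_(1, n) := v - delta_mx 0 k.
have -> : \matrix_(i, j) (if i == k then v 0 j else (i == j)%:R) = 1%:M + U *m V.
  apply/matrixP => i j; rewrite !mxE big_ord1 !mxE eqxx andbT /=.
  case: eqVneq => [->|ik]; last by rewrite mul0r addr0.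
  by rewrite mul1r (eq_sym j k); ring.
rewrite det_1_mulmx [_ + _]mx11_scalar det_scalar1 !mxE (bigD1 k) //= !mxE !eqxx /=.
rewrite big1 ?addr0 ?mulr1; first by ring.
by move=> i /negPf ik; rewrite !mxE ik /= mulr0.
Qed.

(** [B - 1] factors through the rows in [Y], so that [det_1_mulmx] exchanges a
    determinant of size [n] for one of size [#|Y|]. *)
Lemma det_identity_rows n (x0 : 'I_n) (Y : {set 'I_n}) (B : 'M[K]_n) :
  (forall i j, i \notin Y -> B i j = (i == j)%:R) ->
  \det B = \det (\matrix_(a < #|Y|, b < #|Y|) B (nth x0 (enum Y) a) (nth x0 (enum Y) b)).
Proof.
move=> BY.
pose U : 'M[K]_(n, #|Y|) := \matrix_(i, a) (i == nth x0 (enum Y) a)%:R.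
pose V : 'M[K]_(#|Y|, n) :=
  \matrix_(a, j) (B (nth x0 (enum Y) a) j - (nth x0 (enum Y) a == j)%:R).
have BE : B = 1%:M + U *m V.
  apply/matrixP => i j; rewrite !mxE.
  case: (boolP (i \in Y)) => iY.
    rewrite (bigD1 (enum_rank_in iY i)) //= big1 => [|a ai]; rewrite !mxE.
      by rewrite -enum_val_nth enum_rankK_in // eqxx mul1r addr0 addrC subrK.
    rewrite -enum_val_nth; case: eqP => [E|_]; last by rewrite mul0r.
    have E' : a = enum_rank_in iY i by apply: enum_val_inj; rewrite enum_rankK_in.
    by rewrite E' eqxx in ai.
  rewrite big1 ?addr0 ?BY // => a _; rewrite !mxE -enum_val_nth.
  case: eqP => [E|_]; last by rewrite mul0r.
  by move: iY; rewrite E enum_valP.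
rewrite {1}BE det_1_mulmx; congr (\det _); apply/matrixP => a b; rewrite !mxE.
rewrite (bigD1 (nth x0 (enum Y) b)) //= big1 => [|i /negPf ib]; rewrite !mxE; last first.
  by rewrite ib mulr0.
by rewrite eqxx mulr1 addr0 -!enum_val_nth (inj_eq enum_val_inj) addrC subrK.
Qed.

Lemma det_nth m m' (F : nat -> nat -> K) : m = m' ->
  \det (\matrix_(a < m, b < m) F a b) = \det (\matrix_(a < m', b < m') F a b).
Proof. by move=> ->. Qed.

End Determinants.

Section Minors.
Variables (K : numFieldType) (n : nat).
Implicit Types (A B : 'M[K]_n) (S X Y : {set 'I_n}) (i j k l : 'I_n).

(** The two index sequences with the same default value [x0], so that [X] and [Y]
    can be exchanged. *)
Lemma minorE (x0 : 'I_n) A X Y : #|X| = #|Y| ->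
  minor A X Y = \det (\matrix_(a < #|X|, b < #|X|)
     A (nth x0 (enum X) a) (nth x0 (enum Y) b)).
Proof.
move=> XY; congr (\det _); apply/matrixP => a b; rewrite !mxE (enum_val_nth x0).
by congr (A _ _); apply: set_nth_default; rewrite -cardE -XY.
Qed.

Lemma minor_set0 A : minor A set0 set0 = 1.
Proof. by rewrite /minor; move: (\matrix_(a, b) _); rewrite cards0 => M; exact: det_mx00. Qed.

Lemma minor_tr A X Y : #|X| = #|Y| -> minor A^T X Y = minor A Y X.
Proof.
case: (set_0Vmem X) => [->|[x0 _]] XY.
  rewrite cards0 in XY; have /eqP := esym XY; rewrite cards_eq0 => /eqP ->.
  by rewrite !minor_set0.
rewrite (minorE x0 _ XY) (minorE x0 _ (esym XY)) -det_tr.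
rewrite (@det_nth _ _ _ (fun a b => A (nth x0 (enum Y) a) (nth x0 (enum X) b)) (esym XY)).
by congr (\det _); apply/matrixP => a b; rewrite !mxE.
Qed.

Lemma minor_map (f : {rmorphism K -> K}) A X Y : minor (map_mx f A) X Y = f (minor A X Y).
Proof.
rewrite /minor -det_map_mx; congr (\det _); apply/matrixP => a b; by rewrite !mxE.
Qed.

(** The rows of [A] in [S], completed by rows of the identity: its determinant is
    the principal minor of [S]. *)
Definition rows_of A S : 'M[K]_n :=
  \matrix_(i, j) (if i \in S then A i j else (i == j)%:R).

Definition pminor A S : K := \det (rows_of A S).

Lemma pminor0 A : pminor A set0 = 1.
Proof.
by rewrite -(det1 K n); congr (\det _); apply/matrixP => i j; rewrite !mxE inE.
Qed.

Lemma minor_principal A S : minor A S S = pminor A S.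
Proof.
case: (set_0Vmem S) => [->|[x0 _]]; first by rewrite minor_set0 pminor0.
rewrite (minorE x0 _ (erefl _)) /pminor (@det_identity_rows _ _ x0 S).
  congr (\det _); apply/matrixP => a b; rewrite !mxE.
  by rewrite -(enum_val_nth x0) enum_valP.
by move=> i j iS; rewrite mxE (negPf iS).
Qed.

(** Up to a sign, its determinant is the almost-principal minor with rows [j |: S] and
    columns [k |: S]: the row of [j] stands at the rank of [k]. *)
Definition border_rows A S j k : 'M[K]_n :=
  \matrix_(i, l) (if i == k then A j l else rows_of A S i l).

(** Moving [j] from the rank of [k] to its own rank permutes the rows in a way that
    does not depend on the matrix; the value of the sign does not matter. *)
Lemma minor_border_sign S j k : j \notin S -> k \notin S ->
  exists b : bool, forall A,
    minor A (j |: S) (k |: S) = (-1) ^+ b * \det (border_rows A S j k).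
Proof.
move=> jS kS; set X := j |: S; set Y := k |: S.
have XY : #|Y| = #|X| by rewrite !cardsU1 jS kS.
pose f i := if i == k then j else i.
have fX i : i \in Y -> f i \in X.
  rewrite !inE /f; case: (eqVneq i k) => [_|_ /= iS]; first by rewrite eqxx.
  by rewrite iS orbT.
have f_inj : {in Y &, injective f}.
  move=> a b; rewrite !inE /f; case: (eqVneq a k) => [->|ak] /=;
  case: (eqVneq b k) => [->|bk] //= aS bS E.
    by rewrite -E (negPf jS) in bS.
  by rewrite E (negPf jS) in aS.
pose jX : j \in X := setU11 j S.
pose s0 (a : 'I_#|X|) : 'I_#|X| := enum_rank_in jX (f (enum_val (cast_ord (esym XY) a))).
have s0_inj : injective s0.
  move=> a b /(congr1 enum_val); rewrite !enum_rankK_in ?fX ?enum_valP // => /f_inj.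
  by rewrite !enum_valP => /(_ isT isT)/enum_val_inj/cast_ord_inj.
pose s := perm s0_inj.
exists (odd_perm s) => A.
have YX : #|X| = #|Y| := esym XY.
rewrite (@det_identity_rows _ _ j Y); last first.
  move=> a b; rewrite !inE negb_or => /andP[/negPf ak /negPf aS].
  by rewrite !mxE ak aS.
rewrite (minorE j) //.
rewrite (@det_nth _ _ _ (fun a b =>
  border_rows A S j k (nth j (enum Y) a) (nth j (enum Y) b)) XY).
set M := \matrix_(a, b) A _ _; set N := \matrix_(a, b) border_rows _ _ _ _ _ _.
suff -> : N = row_perm s M by rewrite row_permE det_mulmx det_perm signrMK.
apply/matrixP => a b; rewrite !mxE /s permE /s0 -(enum_val_nth j) enum_rankK_in; last first.
  by rewrite fX // enum_valP.
have -> : enum_val (cast_ord (esym XY) a) = nth j (enum Y) a by rewrite (enum_val_nth j).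
rewrite /f; case: eqVneq => // ak.
have : nth j (enum Y) a \in Y by rewrite -mem_enum mem_nth // -cardE XY.
by rewrite !inE (negPf ak) /= => ->.
Qed.

(** At indices outside [S], this is the Schur complement of the block [S] of [A]. *)
Definition schur A S : 'M[K]_n := A *m invmx (rows_of A S).

(** The bordered matrix is [rows_of A S] multiplied by the identity matrix in which the
    row [k] is replaced by the row [j] of [schur A S]. *)
Lemma border_schur A S j k : pminor A S != 0 -> k \notin S ->
  \det (border_rows A S j k) = schur A S j k * pminor A S.
Proof.
move=> nz kS; have u : rows_of A S \in unitmx by rewrite unitmxE unitfE.
have -> : border_rows A S j k =
    (\matrix_(i, l) (if i == k then row j (schur A S) 0 l else (i == l)%:R)) *m rows_of A S.
  apply/row_matrixP => i; rewrite row_mul; case: (eqVneq i k) => [->|ik].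
    have -> : row k (\matrix_(i, l) (if i == k then row j (schur A S) 0 l
        else (i == l)%:R)) = row j (schur A S).
      by apply/rowP => l; rewrite !mxE eqxx.
    rewrite -row_mul /schur mulmxKV //.
    by apply/rowP => l; rewrite !mxE eqxx.
  have -> : row i (\matrix_(i, l) (if i == k then row j (schur A S) 0 l
        else (i == l)%:R)) = row i 1%:M.
    by apply/rowP => l; rewrite !mxE (negPf ik).
  by rewrite -row_mul mul1mx; apply/rowP => l; rewrite !mxE (negPf ik).
by rewrite det_mulmx det_replace_row mxE.
Qed.

Lemma border_diag A S k : border_rows A S k k = rows_of A (k |: S).
Proof. by apply/matrixP => i j; rewrite !mxE !inE; case: eqVneq => [->|]. Qed.

Lemma pminorU1 A S k : pminor A S != 0 -> k \notin S ->
  pminor A (k |: S) = schur A S k k * pminor A S.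
Proof. by move=> nz kS; rewrite {1}/pminor -border_diag border_schur. Qed.

(** One step of Gaussian elimination. *)
Lemma schurU1 A S k i l : pminor A S != 0 -> pminor A (k |: S) != 0 -> k \notin S ->
  l != k -> schur A (k |: S) i l =
    schur A S i l - schur A S i k * schur A S k l / schur A S k k.
Proof.
move=> nz nzk kS lk; have u : rows_of A S \in unitmx by rewrite unitmxE unitfE.
have uk : rows_of A (k |: S) \in unitmx by rewrite unitmxE unitfE.
have kk0 : schur A S k k != 0.
  by move: nzk; rewrite pminorU1 // mulf_eq0 negb_or => /andP[].
pose E : 'M[K]_n := \matrix_(a, b) (if a == k then schur A S k b else (a == b)%:R).
have EN : rows_of A (k |: S) = E *m rows_of A S.
  apply/row_matrixP => a; rewrite row_mul; case: (eqVneq a k) => [->|ak].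
    have -> : row k E = row k (schur A S) by apply/rowP => b; rewrite !mxE eqxx.
    rewrite -row_mul /schur mulmxKV //.
    by apply/rowP => b; rewrite !mxE setU11.
  have -> : row a E = row a 1%:M by apply/rowP => b; rewrite !mxE (negPf ak).
  by rewrite -row_mul mul1mx; apply/rowP => b; rewrite !mxE !inE (negPf ak).
have CE : schur A S = schur A (k |: S) *m E.
  rewrite /schur; have -> : E = rows_of A (k |: S) *m invmx (rows_of A S).
    by rewrite EN mulmxK.
  by rewrite mulmxA mulmxKV.
have EE a b : E a b = if a == k then schur A S k b else (a == b)%:R by rewrite mxE.
have Ck a : schur A S a k = schur A (k |: S) a k * schur A S k k.
  rewrite {1}CE mxE (bigD1 k) //= EE eqxx big1 ?addr0 // => b /negPf bk.
  by rewrite EE bk mulr0.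
have Cl : schur A S i l = schur A (k |: S) i k * schur A S k l + schur A (k |: S) i l.
  rewrite {1}CE mxE (bigD1 k) //= EE eqxx (bigD1 l) //= EE (negPf lk) eqxx mulr1.
  rewrite big1 ?addr0 // => b /andP[/negPf bk /negPf bl].
  by rewrite EE bk bl mulr0.
rewrite Cl Ck; field; exact: kk0.
Qed.

Section Nonzero.
Variable A : 'M[K]_n.
Hypothesis nz : forall S, pminor A S != 0.

Lemma pminor_tr S : pminor A^T S = pminor A S.
Proof. by rewrite -!minor_principal minor_tr. Qed.

Lemma schur0 (B : 'M[K]_n) i j : schur B set0 i j = B i j.
Proof.
rewrite /schur; suff -> : rows_of B set0 = 1%:M by rewrite invmx1 mulmx1.
by apply/matrixP => a b; rewrite !mxE inE.
Qed.

(** Elimination steps commute with transposition. *)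
Lemma schur_tr S j k : j \notin S -> k \notin S -> schur A^T S j k = schur A S k j.
Proof.
move: {2}#|S| (erefl #|S|) => m; elim: m S j k => [|m IH] S j k.
  by move/eqP; rewrite cards_eq0 => /eqP -> _ _; rewrite !schur0 mxE.
move=> Sm jS kS; have /card_gt0P[i iS] : (0 < #|S|)%N by rewrite Sm.
have SE : S = i |: (S :\ i) by rewrite setD1K.
have iS' : i \notin S :\ i by rewrite !inE eqxx.
have Sm' : #|S :\ i| = m by move: Sm; rewrite (cardsD1 i) iS => -[].
have jS' : j \notin S :\ i by rewrite inE (negPf jS) andbF.
have kS' : k \notin S :\ i by rewrite inE (negPf kS) andbF.
have ki : k != i by apply: contraNneq kS => ->.
have ji : j != i by apply: contraNneq jS => ->.
rewrite SE schurU1 ?pminor_tr // schurU1 // !IH //.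
by rewrite (mulrC (schur A _ i j)).
Qed.

(** That the sign is common to both makes conjugate minors the same as conjugate
    entries; the second one is the first one for the transpose. *)
Lemma minor_schur S j k : j \notin S -> k \notin S ->
  exists b : bool,
    minor A (j |: S) (k |: S) = (-1) ^+ b * (schur A S j k * pminor A S) /\
    minor A (k |: S) (j |: S) = (-1) ^+ b * (schur A S k j * pminor A S).
Proof.
move=> jS kS; have [b hb] := minor_border_sign jS kS; exists b; split.
  by rewrite hb border_schur.
have c : #|j |: S| = #|k |: S| by rewrite !cardsU1 jS kS.
by rewrite -minor_tr // hb border_schur ?pminor_tr // schur_tr.
Qed.

Lemma pminorU2 S j k : j \notin S -> k \notin S -> j != k ->
  pminor A (j |: (k |: S)) =
  (schur A S j j * schur A S k k - schur A S j k * schur A S k j) * pminor A S.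
Proof.
move=> jS kS jk; have kk0 : schur A S k k != 0.
  by have := nz (k |: S); rewrite pminorU1 // mulf_eq0 negb_or => /andP[].
rewrite pminorU1 ?schurU1 //; last by rewrite !inE negb_or jk.
by rewrite pminorU1 //; field; exact: kk0.
Qed.

(** Sylvester's identity: the expansion of a determinant of size 2 of the Schur
    complement. *)
Lemma minor_sylvester S j k : j \notin S -> k \notin S -> j != k ->
  minor A (j |: S) (k |: S) * minor A (k |: S) (j |: S) =
  pminor A (j |: S) * pminor A (k |: S) - pminor A S * pminor A (j |: (k |: S)).
Proof.
move=> jS kS jk; have [b [-> ->]] := minor_schur jS kS.
rewrite mulrACA -signr_addb addbb mul1r pminorU2 // !pminorU1 //; ring.
Qed.

End Nonzero.
End Minors.

(** * Hermitian matrices and positive minors *)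

(** [c] stands for the identity of the reals or the conjugation of the complex
    numbers. *)
Section Hermitian.
Variables (K : numFieldType) (c : {rmorphism K -> K}).
Hypothesis cK : involutive c.
Hypothesis c_real : forall x, x \is Num.real -> c x = x.
Hypothesis c_norm : forall x, x * c x = `|x| ^+ 2.
Variable n : nat.
Implicit Types (A : 'M[K]_n) (S : {set 'I_n}) (i j k l : 'I_n).

Lemma c_pos x : 0 < x -> c x = x.
Proof. by move=> x0; apply: c_real; apply: gtr0_real. Qed.

Lemma rows_of_unit A S : pminor A S != 0 -> rows_of A S \in unitmx.
Proof. by move=> nz; rewrite unitmxE unitfE. Qed.

(** The column of index [k] of the inverse of [rows_of A S] is the vector supported
    by [S] and [k], with coordinate 1 at [k], that [A] maps to 0 on [S]. *)
Lemma inv_rows_outside A S i k : pminor A S != 0 -> i \notin S ->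
  invmx (rows_of A S) i k = (i == k)%:R.
Proof.
move=> nz iS; have := mulmxV (rows_of_unit nz).
move=> /matrixP/(_ i k); rewrite !mxE (bigD1 i) //= big1 => [|l /negPf li].
  by rewrite !mxE (negPf iS) eqxx mul1r addr0.
by rewrite !mxE (negPf iS) eq_sym li mul0r.
Qed.

Lemma inv_rows_inside A S i k : pminor A S != 0 -> i \in S ->
  schur A S i k = (i == k)%:R.
Proof.
move=> nz iS; have := mulmxV (rows_of_unit nz).
move=> /matrixP/(_ i k); rewrite /schur !mxE => <-.
by apply: eq_bigr => l _; rewrite mxE iS.
Qed.

Section Posdef.
Variable A : 'M[K]_n.

(** The quotient of the minors of [i |: S] and [S] is the value of the form at the vector
    of [inv_rows_outside]. *)
Lemma posdef_pminor : posdef_hermitian c A -> forall S, 0 < pminor A S.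
Proof.
move=> [_ pos] S; move: {2}#|S| (erefl #|S|) => m; elim: m S => [|m IH] S.
  by move/eqP; rewrite cards_eq0 => /eqP ->; rewrite pminor0 ltr01.
move=> Sm; have /card_gt0P[i iS] : (0 < #|S|)%N by rewrite Sm.
rewrite -(setD1K iS); set S' := S :\ i.
have iS' : i \notin S' by rewrite !inE eqxx.
have Sm' : #|S'| = m by move: Sm; rewrite (cardsD1 i) iS => -[].
have nz : pminor A S' != 0 by rewrite gt_eqF // IH.
rewrite pminorU1 // mulr_gt0 ?IH //.
pose x := col i (invmx (rows_of A S')).
have xi : x i ord0 = 1 by rewrite mxE inv_rows_outside // eqxx.
have x0 : x != 0.
  by apply/eqP => x0; move/eqP: xi; rewrite x0 mxE eq_sym oner_eq0.
suff -> : schur A S' i i = (map_mx c x^T *m A *m x) ord0 ord0 by apply: pos.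
have Ax l : (A *m x) l ord0 = schur A S' l i.
  by rewrite /schur !mxE; apply: eq_bigr => a _; rewrite mxE.
have cx l : map_mx c x^T ord0 l = c (x l ord0) by rewrite !mxE.
rewrite -mulmxA [RHS]mxE (bigD1 i) //= Ax cx xi rmorph1 mul1r big1 ?addr0 // => l li.
rewrite Ax cx; case: (boolP (l \in S')) => lS.
  by rewrite inv_rows_inside // (negPf li) mulr0.
by rewrite mxE inv_rows_outside // (negPf li) rmorph0 mul0r.
Qed.

Definition initial (m : nat) : {set 'I_n} := [set l : 'I_n | (l < m)%N].

Lemma initialS (k : 'I_n) : initial k.+1 = k |: initial k.
Proof. by apply/setP => l; rewrite !inE ltnS leq_eqVlt. Qed.

(** Sylvester's criterion. The vectors supported by [0..k], with last coordinate 1, that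
    [A] maps to 0 on [0..k-1] form a basis that is orthogonal for the form; the value of
    the form at such a vector is a quotient of consecutive leading minors. *)
Lemma pminor_posdef : map_mx c A^T = A ->
  (forall m, (m <= n)%N -> 0 < pminor A (initial m)) -> posdef_hermitian c A.
Proof.
move=> herm pos; split => // x x0.
have pk (k : 'I_n) : 0 < pminor A (initial k) by apply: pos; apply: ltnW.
have nk (k : 'I_n) : pminor A (initial k) != 0 by rewrite gt_eqF.
have kk (k : 'I_n) : k \notin initial k by rewrite inE ltnn.
pose D k := schur A (initial k) k k.
have D0 k : 0 < D k.
  have : 0 < pminor A (initial k.+1) := pos _ (ltn_ord k).
  by rewrite initialS pminorU1 // pmulr_lgt0.
pose X : 'M[K]_n := \matrix_(i, k) invmx (rows_of A (initial k)) i k.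
have Xlow i k : (k <= i)%N -> X i k = (i == k)%:R.
  by move=> ki; rewrite mxE inv_rows_outside // inE -leqNgt.
have AX i k : (A *m X) i k = schur A (initial k) i k.
  by rewrite /schur !mxE; apply: eq_bigr => a _; rewrite mxE.
have AXlow i k : (i < k)%N -> (A *m X) i k = 0.
  move=> ik; rewrite AX inv_rows_inside ?inE // -val_eqE /=.
  by rewrite (ltn_eqF ik).
have Xu : X \in unitmx.
  rewrite -unitmx_tr unitmxE det_trig; last first.
    by apply/is_trig_mxP => i k ik; rewrite mxE Xlow 1?ltnW // -val_eqE /= gtn_eqF.
  by rewrite big1 ?unitr1 // => i _; rewrite mxE Xlow // eqxx.
pose G := map_mx c X^T *m A *m X.
have cX j i : map_mx c X^T j i = c (X i j) by rewrite !mxE.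
have Gup j k : (j < k)%N -> G j k = 0.
  move=> jk; rewrite /G -mulmxA mxE big1 // => i _.
  case: (ltnP i k) => ik; first by rewrite AXlow // mulr0.
  have ji := leq_trans jk ik.
  by rewrite cX Xlow 1?ltnW // -val_eqE gtn_eqF // rmorph0 mul0r.
have Gdiag k : G k k = D k.
  rewrite /G -mulmxA mxE (bigD1 k) //= AX big1 => [|i ik].
    by rewrite cX Xlow // eqxx rmorph1 mul1r addr0.
  case: (ltngtP i k) => lt; last by rewrite (val_inj lt) eqxx in ik.
    by rewrite AXlow // mulr0.
  by rewrite cX Xlow ?(ltnW lt) // (negPf ik) rmorph0 mul0r.
have Gherm : map_mx c G^T = G.
  rewrite /G !trmx_mul !map_mxM /= -mulmxA; congr (_ *m _).
  by rewrite herm; congr (_ *m _); apply/matrixP => i k; rewrite !mxE cK.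
have Goff j k : j != k -> G j k = 0.
  rewrite -val_eqE /= neq_ltn => /orP[|kj]; first exact: Gup.
  have <- : map_mx c G^T j k = G j k by rewrite Gherm.
  by rewrite mxE [G^T j k]mxE Gup // rmorph0.
pose y := invmx X *m x.
have xy : x = X *m y by rewrite mulKVmx.
have y0 : y != 0 by apply: contra_neq x0 => y0; rewrite xy y0 mulmx0.
have -> : map_mx c x^T *m A *m x = map_mx c y^T *m (G *m y).
  by rewrite {1 2}xy trmx_mul map_mxM /G !mulmxA.
have term k : map_mx c y^T ord0 k * (G *m y) k ord0 = D k * `|y k ord0| ^+ 2.
  have -> : map_mx c y^T ord0 k = c (y k ord0) by rewrite !mxE.
  rewrite [(G *m y) k ord0]mxE (bigD1 k) //= big1 => [|l lk]; last by rewrite Goff ?mul0r // eq_sym.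
  by rewrite addr0 Gdiag mulrCA -c_norm (mulrC (y k ord0)).
rewrite mxE; under eq_bigr do rewrite term.
have /cV0Pn[i yi] := y0.
rewrite (bigD1 i) //= ltr_pwDl //; first by rewrite mulr_gt0 // exprn_gt0 // normr_gt0.
by apply: sumr_ge0 => k _; rewrite mulr_ge0 ?(ltW (D0 k)) // exprn_ge0.
Qed.

End Posdef.

(** What a positive Hermitian network says about the matrix at the face <S; j, k>. *)
Definition hermitian_face A S j k :=
  [/\ 0 < pminor A S, 0 < pminor A (j |: S), 0 < pminor A (k |: S),
      0 < pminor A (j |: (k |: S)) & schur A S j k = c (schur A S k j)].

Section Cube.
Variable A : 'M[K]_n.
Hypothesis nz : forall S, pminor A S != 0.

(** The faces around the center [S] + [x], [z] of a hexagon give those around the center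
    [S] + [y]. The entry at [x], [z] is given; the defects [h1], [h2] of the entries at
    [x], [y] and [y], [z] satisfy a homogeneous linear system, whose determinant is the
    minor of the given center divided by that of [S]. *)
Lemma hermitian_cube S (x y z : 'I_n) : (x < y)%N -> (y < z)%N ->
  x \notin S -> y \notin S -> z \notin S ->
  hermitian_face A S x z -> hermitian_face A (z |: S) x y ->
  hermitian_face A (x |: S) y z ->
  [/\ hermitian_face A S x y, hermitian_face A S y z & hermitian_face A (y |: S) x z].
Proof.
move=> xy yz xS yS zS.
have [nxy nyz nxz] : [/\ x != y, y != z & x != z].
  by rewrite -!val_eqE !neq_ltn xy yz (ltn_trans xy yz).
have [nyx nzy nzx] : [/\ y != x, z != y & z != x] by split; rewrite eq_sym.
move=> [d0 dx dz dxz Hxz] [_ dzx dzy dzxy Hxy] [_ dxy' _ _ Hyz].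
have dxy : 0 < pminor A (x |: (y |: S)) by rewrite setUCA.
have dyz : 0 < pminor A (y |: (z |: S)) by [].
have C0 i : i \notin S -> schur A S i i != 0.
  by move=> iS; have := nz (i |: S); rewrite pminorU1 // mulf_eq0 negb_or => /andP[].
have Cpos i : i \notin S -> (0 < pminor A (i |: S)) = (0 < schur A S i i).
  by move=> iS; rewrite pminorU1 // pmulr_lgt0.
rewrite !schurU1 // in Hxy Hyz.
have Cx : 0 < schur A S x x by rewrite -Cpos.
have Cz : 0 < schur A S z z by rewrite -Cpos.
set a := schur A S in Hxz Hxy Hyz C0 Cpos Cx Cz *.
have det_xz : a x x * a z z - a x z * a z x != 0.
  by have := nz (x |: (z |: S)); rewrite pminorU2 // mulf_eq0 negb_or => /andP[].
have cx : c (a x x) = a x x := c_pos Cx.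
have cz : c (a z z) = a z z := c_pos Cz.
have cxz : c (a x z) = a z x by rewrite Hxz cK.
have {}Hyz := congr1 c Hyz; rewrite cK in Hyz.
rewrite !(rmorphB, rmorphM, fmorphV) /= in Hxy Hyz.
rewrite cz -Hxz in Hxy; rewrite cx cxz in Hyz.
pose h1 := a x y - c (a y x); pose h2 := c (a y z) - a z y.
have Cx0 : a x x != 0 by rewrite gt_eqF.
have Cz0 : a z z != 0 by rewrite gt_eqF.
have e1 : a z z * h1 + a x z * h2 = 0.
  have -> : a z z * h1 + a x z * h2 =
    a z z * ((a x y - a x z * a z y / a z z) - (c (a y x) - c (a y z) * a x z / a z z)).
    by rewrite /h1 /h2; field.
  by rewrite Hxy subrr mulr0.
have e2 : a z x * h1 + a x x * h2 = 0.
  have -> : a z x * h1 + a x x * h2 =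
    a x x * ((c (a y z) - c (a y x) * a z x / a x x) - (a z y - a z x * a x y / a x x)).
    by rewrite /h1 /h2; field.
  by rewrite Hyz subrr mulr0.
have h10 : h1 = 0.
  apply/eqP; have : (a x x * a z z - a x z * a z x) * h1 = 0.
    have -> : (a x x * a z z - a x z * a z x) * h1 =
      a x x * (a z z * h1 + a x z * h2) - a x z * (a z x * h1 + a x x * h2) by ring.
    by rewrite e1 e2 !mulr0 subrr.
  by move/eqP; rewrite mulf_eq0 (negPf det_xz).
have h20 : h2 = 0.
  by move/eqP: e2; rewrite h10 mulr0 add0r mulf_eq0 (negPf Cx0) => /eqP.
have Exy : a x y = c (a y x) by apply/eqP; rewrite -subr_eq0 -/h1 h10.
have Eyz : a y z = c (a z y).
  by rewrite -[a y z]cK; congr (c _); apply/eqP; rewrite -subr_eq0 -/h2 h20.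
have Cy : 0 < a y y.
  have : 0 < a x x * a y y - a x y * a y x.
    by move: dxy; rewrite pminorU2 // pmulr_lgt0.
  have n0 : 0 <= a x y * a y x.
    by rewrite {1}Exy mulrC c_norm exprn_ge0.
  move=> h; have : 0 < a x x * a y y by apply: le_lt_trans n0 _; rewrite -subr_gt0.
  by rewrite pmulr_rgt0.
have dy : 0 < pminor A (y |: S) by rewrite Cpos.
have cy : c (a y y) = a y y := c_pos Cy.
split; split => //.
- by rewrite setUCA.
- by rewrite (setUCA [set z]).
- rewrite !schurU1 // -/a !(rmorphB, rmorphM, fmorphV) /= cy -Exy -Hxz.
  by rewrite -[c (a z y)]Eyz (mulrC (a x y)).
Qed.
End Cube.

(** The column [k] of the inverse of [rows_of A S] is determined by the entries of [A]
    with row in [S] and column in [k |: S]. *)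
Lemma schur_ext A B S j k : pminor A S != 0 -> pminor B S != 0 -> k \notin S ->
  (forall s l, s \in S -> l \in k |: S -> A s l = B s l) ->
  (forall l, l \in S -> A j l = B j l) ->
  schur A S j k - A j k = schur B S j k - B j k.
Proof.
move=> nA nB kS AB ABj.
have zero l : l \notin k |: S -> invmx (rows_of A S) l k = 0.
  by rewrite !inE negb_or => /andP[/negPf lk lS]; rewrite inv_rows_outside // lk.
have xE l : invmx (rows_of A S) l k = invmx (rows_of B S) l k.
  have E : rows_of B S *m col k (invmx (rows_of A S)) = delta_mx k 0.
    apply/colP => i; rewrite !mxE andbT; case: (boolP (i \in S)) => iS.
      rewrite -(inv_rows_inside k nA iS) /schur mxE; apply: eq_bigr => a _.
      rewrite !mxE iS; case: (boolP (a \in k |: S)) => ak; first by rewrite AB.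
      by rewrite zero // !mulr0.
    rewrite (bigD1 i) //= !mxE (negPf iS) eqxx mul1r inv_rows_outside // big1 ?addr0 //.
    by move=> a /negPf ai; rewrite !mxE (negPf iS) eq_sym ai mul0r.
  have -> : invmx (rows_of B S) l k = (invmx (rows_of B S) *m delta_mx k 0 : 'cV_n) l 0.
    by rewrite -colE mxE.
  by rewrite -E mulKmx ?rows_of_unit // mxE.
have sE (M : 'M[K]_n) : pminor M S != 0 ->
    schur M S j k - M j k = \sum_(l | l != k) M j l * invmx (rows_of M S) l k.
  move=> nM; rewrite /schur mxE (bigD1 k) //= inv_rows_outside // eqxx mulr1.
  by rewrite addrAC subrr add0r.
rewrite !sE //; apply: eq_bigr => l lk; rewrite -xE.
case: (boolP (l \in S)) => lS; first by rewrite ABj.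
by rewrite zero ?mulr0 // !inE negb_or lk.
Qed.

Lemma schur_map A S j k : schur (map_mx c A) S j k = c (schur A S j k).
Proof.
have -> : schur (map_mx c A) S = map_mx c (schur A S); last by rewrite mxE.
rewrite /schur map_mxM map_invmx; congr (_ *m invmx _).
by apply/matrixP => a b; rewrite !mxE; case: ifP => // _; case: eqP => _; rewrite ?rmorph0 ?rmorph1.
Qed.

(** The Schur complement of the open interval from [j] to [k] differs from the entry
    at [j], [k] by an expression in entries closer to the diagonal. So the matrix and its
    adjoint are equal by induction on the distance to the diagonal. *)
Lemma hermitian_intervals A : (2 <= n)%N -> (forall S, pminor A S != 0) ->
  (forall j k, (j < k)%N -> hermitian_face A [set l : 'I_n | (j < l < k)%N] j k) ->
  posdef_hermitian c A.
Proof.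
move=> n_ge2 nz face; pose B := map_mx c A^T.
have nB S : pminor B S != 0.
  by rewrite -minor_principal minor_map minor_principal pminor_tr // fmorph_eq0.
have BE i j : B i j = c (A j i) by rewrite !mxE.
have diag j : B j j = A j j.
  rewrite BE; apply: c_pos.
  have p1 : pminor A [set j] = A j j.
    by rewrite -[[set j]]setU0 pminorU1 ?inE // pminor0 mulr1 schur0.
  rewrite -p1; case: (ltnP j.+1 n) => jn.
    have [_ + _ _ _] := face j (Ordinal jn) (ltnSn j).
    by rewrite (_ : [set l | _] = set0) ?setU0 //; apply/setP => l; rewrite !inE /=; lia.
  have jn' : (j.-1 < n)%N by have := ltn_ord j; lia.
  have lt : (Ordinal jn' < j)%N by rewrite /=; lia.
  have [_ _ + _ _] := face _ _ lt.
  by rewrite (_ : [set l | _] = set0) ?setU0 //; apply/setP => l; rewrite !inE /=; lia.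
have herm m j k : (j <= k)%N -> (k - j <= m)%N -> A j k = B j k /\ A k j = B k j.
  elim: m j k => [|m IH] j k jk dist.
    have -> : j = k by apply: val_inj; move: jk dist => /=; lia.
    by rewrite diag.
  move: jk; rewrite leq_eqVlt => /orP[/eqP/val_inj ->|jk]; first by rewrite diag.
  pose S := [set l : 'I_n | (j < l < k)%N].
  have jS : j \notin S by rewrite inE ltnn.
  have kS : k \notin S by rewrite inE ltnn andbF.
  have IH' (a b : 'I_n) : (j <= a <= k)%N -> (j <= b <= k)%N -> (j < a)%N || (b < k)%N ->
      (j < b)%N || (a < k)%N -> A a b = B a b.
    move=> ha hb h1 h2; case: (leqP a b) => ab; first by have [|-> _] := IH a b ab; first lia.
    by have [|_ ->] := IH b a (ltnW ab); first lia.
  have E : schur A S j k - A j k = schur B S j k - B j k.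
    apply: schur_ext => // [s l|l]; rewrite !inE.
      by move=> /andP[s1 s2] /orP[/eqP ->|/andP[l1 l2]]; apply: IH'; lia.
    by move=> /andP[l1 l2]; apply: IH'; lia.
  have [_ _ _ _ H] := face j k jk.
  have AB : A j k = B j k.
    move: E; rewrite H /B schur_map schur_tr // => /eqP.
    by rewrite (inj_eq (addrI _)) (inj_eq oppr_inj) => /eqP.
  by split => //; rewrite BE AB BE cK.
have hA : map_mx c A^T = A.
  apply/matrixP => i j; rewrite -/B; case: (leqP i j) => [le|/ltnW le].
    by have [-> _] := herm _ i j le (leqnn _).
  by have [_ ->] := herm _ j i le (leqnn _).
apply: pminor_posdef => // m mn.
case: m mn => [|m] mn.
  by rewrite (_ : initial 0 = set0) ?pminor0 ?ltr01 //; apply/setP => l; rewrite !inE.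
have i0 : (0 < n)%N by lia.
case: m mn => [|m] mn.
  have lt : (Ordinal i0 < Ordinal n_ge2)%N by [].
  have [_ + _ _ _] := face _ _ lt.
  rewrite (_ : [set l | _] = set0) ?setU0; last by apply/setP => l; rewrite !inE /=; lia.
  congr (0 < pminor A _); apply/setP => l; rewrite !inE -val_eqE /=; lia.
have lt : (Ordinal i0 < Ordinal mn)%N by [].
have [_ _ _ + _] := face _ _ lt.
congr (0 < pminor A _); apply/setP => l; rewrite !inE -!val_eqE /=; lia.
Qed.

End Hermitian.

(** * Turning over triangles of strips *)

(** [r x a] orders the tiles of the strip of [x]: it decreases in the direction in
    which indices larger than [x] enter the label and smaller ones leave it. *)
Section Sweep.
Local Open Scope nat_scope.
Variable n : nat.
Implicit Types (a b c i l x y z : 'I_n) (r : 'I_n -> 'I_n -> nat).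

(** Whether the label of the tile of [x] and [y] contains [l], as read on the strip of
    [x]: the tile lies above the strip of [l]. *)
Definition above r l x y := (x < l) == (r x y < r x l).

(** The strip of [x] and the strip of [y] give the same label to their common tile. *)
Definition strip_orders r :=
  (forall x a b, x != a -> x != b -> a != b -> r x a != r x b) /\
  (forall l x y, l != x -> l != y -> x != y -> above r l x y = above r l y x).

Definition face r x y := [set l | [&& l != x, l != y & above r l x y]].

(** When no other strip meets the triangle of [a < b < c], the center of its hexagon is
    some [S] with [a] and [c] if the triple is inverted, and [S] with [b] if not. *)
Definition inversions r :=
  [set t : 'I_n * 'I_n * 'I_n | [&& t.1.1 < t.1.2, t.1.2 < t.2 & above r t.2 t.1.1 t.1.2]].

Definition btw (f : 'I_n -> nat) l a b := (f a < f l < f b) || (f b < f l < f a).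

Section Orders.
Variable r : 'I_n -> 'I_n -> nat.
Hypothesis ro : strip_orders r.

Lemma above_low a b c : a < b -> b < c -> above r a b c = above r c a b.
Proof.
move=> ab bc; have [inj sym] := ro.
have [nab nac nbc] : [/\ a != b, a != c & b != c] by rewrite -!val_eqE /=; split; lia.
have [nba nca ncb] : [/\ b != a, c != a & c != b] by split; rewrite eq_sym.
have := inj a b c nab nac nbc; have := inj b a c nba nbc nac; have := inj c a b nca ncb nab.
have := sym a b c nab nac nbc; have := sym b a c nba nbc nac; have := sym c a b nca ncb nab.
by rewrite /above; lia.
Qed.

Lemma above_mid a b c : a < b -> b < c -> above r b a c = ~~ above r c a b.
Proof.
move=> ab bc; have [inj sym] := ro; rewrite /above.
have [nab nac nbc] : [/\ a != b, a != c & b != c] by rewrite -!val_eqE /=; split; lia.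
by have := inj a b c nab nac nbc; lia.
Qed.

(** Along the strip of [x] the label gains or loses [l] exactly at the tile of [l]. *)
Lemma above_btw x l a b : x != l -> x != a -> x != b -> l != a -> l != b -> a != b ->
  (above r l x a == above r l x b) = ~~ btw (r x) l a b.
Proof.
move=> xl xa xb la lb ab; have [inj sym] := ro; rewrite /above /btw.
have := inj x l a xl xa la; have := inj x l b xl xb lb; lia.
Qed.

Lemma btwC f l a b : btw f l a b = btw f l b a.
Proof. by rewrite /btw orbC. Qed.

Lemma btw_trans f i l a b : btw f l a b -> btw f i a l -> btw f i a b.
Proof. by rewrite /btw; lia. Qed.

Lemma btw_asym f l a b : btw f l a b -> btw f b a l = false.
Proof. by rewrite /btw; lia. Qed.

(** A strip that enters a triangle leaves it through another side: by [above_btw], each of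
    the three labels is compared twice. *)
Lemma btw_parity l x y z : l != x -> l != y -> l != z -> x != y -> x != z -> y != z ->
  btw (r z) l x y = btw (r x) l y z (+) btw (r y) l x z.
Proof.
move=> lx ly lz xy xz yz; have [inj sym] := ro.
have [xl yl zl] : [/\ x != l, y != l & z != l] by split; rewrite eq_sym.
have [yx zx zy] : [/\ y != x, z != x & z != y] by split; rewrite eq_sym.
have := above_btw xl xy xz ly lz yz; have := above_btw yl yx yz lx lz xz.
have := above_btw zl zx zy lx ly xy.
rewrite (sym l z x) // (sym l z y) // (sym l y x) //.
case: (above r l x y); case: (above r l x z); case: (above r l y z);
case: btw; case: btw; case: btw => //.
Qed.

Definition empty_triangle x y z := forall l, l != x -> l != y -> l != z ->
  [/\ ~~ btw (r x) l y z, ~~ btw (r y) l x z & ~~ btw (r z) l x y].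

(** The largest index [z] of an inverted triple is chosen so that strips of larger
    index do not meet the triangles considered. *)
Section Largest.
Variable z : 'I_n.
Hypothesis zmax : forall a b c, a < b -> b < c -> z < c -> ~~ above r c a b.

(* The strips of [x] and [y] cross above that of [z], so that the three form an
   inverted triangle. *)
Let cand x y := [&& x != y, x < z, y < z & above r z x y].
(* The strips that meet the side of the triangle on the strip of [x]. *)
Let side x y := [set l | [&& l != x, l != y, l != z & btw (r x) l z y]].
(* The strips that meet the side of the triangle on the strip of [z]. *)
Let width x y := [set l | [&& l != x, l != y, l != z & btw (r z) l x y]].

Let candC x y : cand x y = cand y x.
Proof.
rewrite /cand (eq_sym x y); case: (eqVneq y x) => //= yx.
case: (ltnP x z) => //= xz; case: (ltnP y z) => //= yz.
move: yx; rewrite -val_eqE /= => yx.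
by have [_ sym] := ro; apply: sym; rewrite -val_eqE /=; lia.
Qed.

Lemma side_cand x y l : cand x y -> l \in side x y -> cand x l /\ side x l \proper side x y.
Proof.
rewrite /cand => /and4P[xy xz yz Az]; rewrite inE => /and4P[lx ly lz b].
have lez : l < z.
  rewrite ltn_neqAle lz /= leqNgt; apply/negP => zl.
  have := above_btw (x := x) (l := l) (a := z) (b := y).
  rewrite b /= (eq_sym x l) lx xy lz ly (eq_sym z y) -(val_eqE x z) -(val_eqE y z) /=.
  have -> : (x == z :> nat) = false by lia.
  have -> : (y == z :> nat) = false by lia.
  move=> /(_ isT isT isT isT isT isT).
  rewrite (negPf (zmax xz zl zl)).
  have -> : above r l x y = false.
    apply/negP; case: (ltngtP x y) => [lt|lt|/val_inj E].
    - by rewrite (negPf (zmax lt (ltn_trans yz zl) zl)).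
    - have [_ sym] := ro; rewrite sym //.
      by rewrite (negPf (zmax lt (ltn_trans xz zl) zl)).
    - by rewrite E eqxx in xy.
  by rewrite eqxx.
split.
  rewrite eq_sym lx xz lez /=; move: Az b; rewrite /above /btw xz; lia.
apply/properP; split; last first.
  by exists l; rewrite inE ?lx ?ly ?lz ?b // eqxx andbF.
apply/subsetP => i; rewrite !inE => /and4P[-> il iz bi] /=.
rewrite iz /= (btw_trans b bi) andbT.
by apply: contraTneq bi => ->; rewrite (btw_asym b).
Qed.

(** Follow the strip of [x] upwards from that of [z] to the first crossing. *)
Lemma side_near x y : cand x y ->
  exists y', [/\ cand x y', side x y' = set0 & y' = y \/ y' \in side x y].
Proof.
move: {2}#|_|.+1 (ltnSn #|side x y|) => m.
elim: m y => // m IH y; rewrite ltnS => le c.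
have [s0|[l ls]] := set_0Vmem (side x y); first by exists y; split; [| |left].
have [cl /[dup] pr /proper_card lt] := side_cand c ls.
have [y' [c' s' or]] := IH l (leq_trans lt le) cl.
exists y'; split => //; right; case: or => [-> //|].
by apply/subsetP/proper_sub.
Qed.

(** Take a triangle with no strip across its side on [x]. If some strip crosses the side
    on [y], the one that does so next to [z] leaves through the side on [z], and
    cuts off a narrower triangle with the same property. *)
Lemma exists_empty x y : cand x y -> exists a b, cand a b /\ empty_triangle a b z.
Proof.
move=> /side_near[y' [c s _]] {y}; move: y' c s => y c s.
move: {2}#|_|.+1 (ltnSn #|width x y|) => m.
elim: m x y c s => // m IH x y c s; rewrite ltnS => le.
have [s0|[y1 y1s]] := set_0Vmem (side y x).
  exists x, y; split => // l lx ly lz.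
  have := in_set0 l; rewrite -s inE lx ly lz /= => /negbT b1.
  have := in_set0 l; rewrite -s0 inE lx ly lz /= => /negbT b2.
  have /and4P[xy xz yz _] := c.
  have [nxz nyz] : x != z /\ y != z by rewrite -!val_eqE !neq_ltn /= xz yz.
  by rewrite (btw_parity (x := x) (y := y)) // (btwC _ _ y z) (negPf b1) (btwC _ _ x z) (negPf b2).
have cyx : cand y x by rewrite candC.
have [c1 _] := side_cand cyx y1s.
have [l [cl sl or]] := side_near c1.
have ls : l \in side y x.
  case: or => [-> //|]; apply/subsetP/proper_sub; exact: (side_cand cyx y1s).2.
apply: (IH y l) => //; apply: leq_trans le; apply/proper_card.
move: ls; rewrite inE => /and4P[ly lx lz b].
have lN : l \notin side x y by rewrite s in_set0.
rewrite inE lx ly lz /= in lN.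
have /and4P[xy xz yz _] := c.
have [nxz nyz] : x != z /\ y != z by rewrite -!val_eqE !neq_ltn /= xz yz.
have bz : btw (r z) l x y.
  by rewrite (btw_parity (x := x) (y := y)) // (btwC _ _ y z) (negPf lN) (btwC _ _ x z) b.
apply/properP; split; last by exists l; rewrite inE ?lx ?ly ?lz ?bz // eqxx andbF.
apply/subsetP => i; rewrite !inE => /and4P[-> il -> bi] /=.
rewrite btwC in bz; rewrite btwC (btw_trans bz bi) andbT.
by apply: contraTneq bi => ->; rewrite (btw_asym bz).
Qed.
End Largest.

Lemma empty_triangle_sym x y z : empty_triangle x y z -> empty_triangle y x z.
Proof. by move=> h l ly lx lz; have [h1 h2 h3] := h l lx ly lz; split => //; rewrite btwC. Qed.

Lemma exists_empty_triangle : inversions r != set0 ->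
  exists x y z, [/\ x < y, y < z, above r z x y & empty_triangle x y z].
Proof.
move=> /set0Pn[[[a0 b0] c0]]; rewrite inE /= => /and3P[ab0 bc0 A0].
pose P c := [exists a : 'I_n, exists b : 'I_n, [&& (a < b)%N, b < c & above r c a b]].
have P0 : P c0 by apply/existsP; exists a0; apply/existsP; exists b0; rewrite ab0 bc0.
case: (arg_maxnP (fun c : 'I_n => c : nat) P0) => z /existsP[a /existsP[b /and3P[ab bz A]]] zmax.
have zmax' a1 b1 c1 : a1 < b1 -> b1 < c1 -> z < c1 -> ~~ above r c1 a1 b1.
  move=> ab1 bc1 zc; apply/negP => A1; suff /zmax : P c1 by rewrite /= leqNgt zc.
  by apply/existsP; exists a1; apply/existsP; exists b1; rewrite ab1 bc1.
have [|x [y [/and4P[xy xz yz Az] et]]] := @exists_empty z zmax' a b.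
  by rewrite A bz (ltn_trans ab bz) -val_eqE neq_ltn ab.
move: (xy); rewrite -val_eqE /= neq_ltn => /orP[lt|lt]; first by exists x, y, z.
have [_ sym] := ro.
exists y, x, z; split => //; last exact: empty_triangle_sym.
by rewrite sym // -val_eqE neq_ltn ?xz ?yz ?orbT //= lt.
Qed.

End Orders.

Section Flip.
Variables (r : 'I_n -> 'I_n -> nat) (x y z : 'I_n).
Hypotheses (ro : strip_orders r) (xy : x < y) (yz : y < z).
Hypothesis et : empty_triangle r x y z.

Definition swap (f : 'I_n -> nat) a b c := f (tperm a b c).

(** Turning over the triangle: each of its strips meets the other two in the opposite
    order. *)
Definition flip a := if a == x then swap (r x) y z
  else if a == y then swap (r y) x z
  else if a == z then swap (r z) x y else r a.

Definition corner3 a := [|| a == x, a == y | a == z].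

(** Exchanging the values at [a] and [b] changes no other comparison when no other value
    lies in between. *)
Lemma swapE f a b c d : a != b -> c != d -> f a != f b ->
  (c != a -> c != b -> [/\ f c != f a, f c != f b & ~~ btw f c a b]) ->
  (d != a -> d != b -> [/\ f d != f a, f d != f b & ~~ btw f d a b]) ->
  (swap f a b c < swap f a b d) =
  (f c < f d) (+) (((c == a) || (c == b)) && ((d == a) || (d == b))).
Proof.
rewrite /swap /btw => ab cd fab hc hd.
have tD i : i != a -> i != b -> tperm a b i = i by move=> ia ib; rewrite tpermD // eq_sym.
have ba : b != a by rewrite eq_sym.
case: (eqVneq c a) cd hc => [->|ca]; case: (eqVneq d a) hd => [->|da].
- by rewrite eqxx.
- case: (eqVneq d b) => [->|db] /= hd _ _; first by rewrite tpermL tpermR; clear -fab; lia.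
  have [h1 h2 h3] := hd isT isT.
  by rewrite tpermL tD //= addbF; clear -h1 h2 h3; lia.
- case: (eqVneq c b) => [->|cb] /= _ _ hc; first by rewrite tpermL tpermR; clear -fab; lia.
  have [h1 h2 h3] := hc isT isT.
  by rewrite tpermL tD //= addbF; clear -h1 h2 h3; lia.
case: (eqVneq c b) => [->|cb]; case: (eqVneq d b) => [->|db] /=.
- by rewrite eqxx.
- move=> hd _ _; have [h1 h2 h3] := hd isT isT.
  by rewrite tpermR tD //= addbF; clear -h1 h2 h3; lia.
- move=> _ _ hc; have [h1 h2 h3] := hc isT isT.
  by rewrite tpermR tD //= addbF; clear -h1 h2 h3; lia.
- by move=> _ _ _; rewrite !tD //= addbF.
Qed.

Let neqs : [/\ x != y, y != z & x != z].
Proof. by rewrite -!val_eqE !neq_ltn xy yz (ltn_trans xy yz). Qed.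

Let swap_lt p q s b c : p != q -> p != s -> q != s ->
  (forall l, l != p -> l != q -> l != s -> ~~ btw (r p) l q s) ->
  p != b -> p != c -> b != c ->
  (swap (r p) q s b < swap (r p) q s c) =
  (r p b < r p c) (+) (((b == q) || (b == s)) && ((c == q) || (c == s))).
Proof.
move=> pq ps qs nb pb pc bc; have [inj _] := ro; apply: swapE => //; first exact: inj.
  by move=> bq bs; split; [apply: inj|apply: inj|apply: nb; rewrite // eq_sym].
by move=> cq cs; split; [apply: inj|apply: inj|apply: nb; rewrite // eq_sym].
Qed.

Lemma flip_lt a b c : a != b -> a != c -> b != c ->
  (flip a b < flip a c) = (r a b < r a c) (+) [&& corner3 a, corner3 b & corner3 c].
Proof.
move=> ab ac bc; have [nxy nyz nxz] := neqs.
have [nyx nzy nzx] : [/\ y != x, z != y & z != x] by split; rewrite eq_sym.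
rewrite /flip /corner3.
case: (eqVneq a x) ab ac => [->|ax] ab ac.
  rewrite swap_lt // => [|l lx ly lz]; last by have [] := et lx ly lz.
  by rewrite !(eq_sym _ x) (negPf ab) (negPf ac).
case: (eqVneq a y) ab ac => [->|ay] ab ac.
  rewrite swap_lt // => [|l ly lx lz]; last by have [] := et lx ly lz.
  by rewrite !(eq_sym _ y) (negPf ab) (negPf ac).
case: (eqVneq a z) ab ac => [->|az] ab ac; last by rewrite addbF.
rewrite swap_lt // => [|l lz lx ly]; last by have [] := et lx ly lz.
by rewrite !(eq_sym _ z) (negPf ab) (negPf ac) !orbF.
Qed.

Lemma above_flip a b l : l != a -> l != b -> a != b ->
  above flip l a b = above r l a b (+) [&& corner3 a, corner3 b & corner3 l].
Proof.
move=> la lb ab; rewrite /above flip_lt // 1?eq_sym //.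
by case: (a < l); case: (_ < _); case: [&& _, _ & _].
Qed.

Lemma flip_orders : strip_orders flip.
Proof.
have [inj sym] := ro; split => [a b c ab ac bc|l a b la lb ab].
  have cb : c != b by rewrite eq_sym.
  have E : [&& corner3 a, corner3 c & corner3 b] = [&& corner3 a, corner3 b & corner3 c].
    by rewrite (andbC (corner3 c)).
  have := inj a b c ab ac bc; have := flip_lt ab ac bc; have := flip_lt ac ab cb.
  rewrite E; case: [&& _, _ & _]; rewrite ?addbT ?addbF; lia.
rewrite !above_flip 1?(eq_sym b) // (sym l a b) //.
by rewrite andbCA.
Qed.

Lemma inversions_flip : above r z x y -> inversions flip \proper inversions r.
Proof.
move=> A; apply/properP; split; last first.
  exists (x, y, z); rewrite inE /= xy yz //=.
  have [nxy nyz nxz] := neqs; have [nzx nzy] : z != x /\ z != y by rewrite !(eq_sym z).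
  by rewrite above_flip // A /corner3 !eqxx !orbT.
apply/subsetP => -[[a b] c]; rewrite !inE /= => /and3P[ab bc].
have [nab nbc nac] : [/\ a != b, b != c & a != c].
  by rewrite -!val_eqE !neq_ltn ab bc (ltn_trans ab bc).
have [nca ncb] : c != a /\ c != b by rewrite !(eq_sym c).
rewrite ab bc above_flip //=.
case: (boolP [&& corner3 a, corner3 b & corner3 c]); last by rewrite addbF.
move=> /and3P[ca cb cc] _; suff [-> -> ->] : [/\ a = x, b = y & c = z] by [].
move: ca cb cc xy yz ab bc; rewrite /corner3.
by case/or3P => /eqP ->; case/or3P => /eqP ->; case/or3P => /eqP -> //; clear; lia.
Qed.

Lemma face_flip a b : a != b -> ~~ (corner3 a && corner3 b) -> face flip a b = face r a b.
Proof.
move=> ab nab; apply/setP => l; rewrite !inE.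
case: (eqVneq l a) => //= la; case: (eqVneq l b) => //= lb.
by rewrite above_flip // andbA (negPf nab) addbF.
Qed.

Lemma face_triangle : above r z x y ->
  [/\ face r x y = z |: face r x z, face r y z = x |: face r x z,
      face flip x y = face r x z, face flip y z = face r x z &
      face flip x z = y |: face r x z].
Proof.
move=> A; have [nxy nyz nxz] := neqs.
have [nyx nzy nzx] : [/\ y != x, z != y & z != x] by split; rewrite eq_sym.
have Ax : above r x y z by rewrite (above_low ro xy yz).
have Ay : above r y x z = false by rewrite (above_mid ro xy yz) A.
have [inj sym] := ro.
have other l : l != x -> l != y -> l != z ->
    above r l x y = above r l x z /\ above r l y z = above r l x z.
  move=> lx ly lz; have [b1 b2 b3] := et lx ly lz.
  have [xl yl zl] : [/\ x != l, y != l & z != l] by split; rewrite eq_sym.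
  have := above_btw ro xl nxy nxz ly lz nyz; rewrite b1 => /eqP E; split => //.
  have := above_btw ro yl nyx nyz lx lz nxz; rewrite b2 => /eqP <-.
  by rewrite sym.
split; apply/setP => l; rewrite !inE.
- case: (eqVneq l z) => [->|lz]; first by rewrite nzx nzy.
  case: (eqVneq l x) => [->|lx] //=; case: (eqVneq l y) => [->|ly] /=.
    by rewrite Ay.
  by have [-> _] := other l lx ly lz.
- case: (eqVneq l x) => [->|lx]; first by rewrite nxy nxz.
  case: (eqVneq l z) => [->|lz] /=; first by rewrite andbF.
  case: (eqVneq l y) => [->|ly] /=; first by rewrite Ay.
  by have [_ ->] := other l lx ly lz.
- case: (eqVneq l x) => [->|lx] //=.
  case: (eqVneq l y) => [->|ly] /=; first by rewrite nyz Ay.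
  case: (eqVneq l z) => [->|lz] /=.
    by rewrite above_flip // A /corner3 !eqxx !orbT.
  rewrite above_flip //; have [-> _] := other l lx ly lz.
  by rewrite /corner3 (negPf lx) (negPf ly) (negPf lz) !andbF addbF.
- case: (eqVneq l z) => [->|lz] //=; first by rewrite !andbF.
  case: (eqVneq l y) => [->|ly] /=; first by rewrite nyx Ay.
  case: (eqVneq l x) => [->|lx] /=.
    by rewrite above_flip // Ax /corner3 !eqxx !orbT.
  rewrite above_flip //; have [_ ->] := other l lx ly lz.
  by rewrite /corner3 (negPf lx) (negPf ly) (negPf lz) !andbF addbF.
- case: (eqVneq l x) => [->|lx] /=; first by rewrite (negPf nxy).
  case: (eqVneq l z) => [->|lz] /=; first by rewrite (negPf nzy).
  case: (eqVneq l y) => [->|ly] /=.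
    by rewrite above_flip // Ay /corner3 !eqxx !orbT.
  rewrite above_flip //.
  by rewrite /corner3 (negPf lx) (negPf ly) (negPf lz) !andbF addbF.
Qed.

End Flip.

Lemma face_no_inversions r x y : strip_orders r -> inversions r = set0 -> x < y ->
  face r x y = [set l : 'I_n | x < l < y].
Proof.
move=> ro I0 xy; apply/setP => l; rewrite !inE -!val_eqE /=.
have noA a b c : a < b -> b < c -> above r c a b = false.
  by move=> ab bc; have := in_set0 (a, b, c); rewrite -I0 inE /= ab bc.
have [lx|xl|//] := ltngtP l x => /=.
  by rewrite (above_low ro lx xy) noA //; lia.
have [ly|yl|//] := ltngtP l y => /=.
  by rewrite (above_mid ro xl ly) noA.
by rewrite noA.
Qed.

(** Each turn removes one inversion. The hypothesis on [P] says that [P] goes through a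
    turn: the faces of an inverted triangle give those of the other shape. *)
Lemma sweep_faces (P : {set 'I_n} -> 'I_n -> 'I_n -> Prop) :
  (forall (S : {set 'I_n}) x y z, x < y -> y < z -> x \notin S -> y \notin S -> z \notin S ->
     P S x z -> P (z |: S) x y -> P (x |: S) y z ->
     [/\ P S x y, P S y z & P (y |: S) x z]) ->
  forall r, strip_orders r -> (forall x y, x < y -> P (face r x y) x y) ->
  forall x y, x < y -> P [set l : 'I_n | x < l < y] x y.
Proof.
move=> cube r; move: {2}#|_|.+1 (ltnSn #|inversions r|) => m.
elim: m r => // m IH r; rewrite ltnS => le ro PF.
case: (eqVneq (inversions r) set0) => [I0|].
  by move=> x y xy; rewrite -(face_no_inversions ro I0 xy); apply: PF.
move=> /(exists_empty_triangle ro)[x [y [z [xy yz A et]]]].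
have xz := ltn_trans xy yz.
have [nxy nyz nxz] : [/\ x != y, y != z & x != z].
  by rewrite -!val_eqE !neq_ltn xy yz xz.
have [Fxy Fyz Gxy Gyz Gxz] := face_triangle ro xy yz et A.
have nx : x \notin face r x z by rewrite inE eqxx.
have nz : z \notin face r x z by rewrite inE eqxx andbF.
have ny : y \notin face r x z by rewrite inE (above_mid ro xy yz) A !andbF.
have [P1 P2 P3] : [/\ P (face r x z) x y, P (face r x z) y z & P (y |: face r x z) x z].
  by apply: cube => //; rewrite -?Fxy -?Fyz; apply: PF.
apply: (IH (flip r x y z)).
- exact: leq_trans (proper_card (inversions_flip ro xy yz et A)) le.
- exact: flip_orders.
move=> a b ab; have nab : a != b by rewrite -val_eqE neq_ltn ab.
case: (boolP (corner3 x y z a && corner3 x y z b)) => [/andP[]|nc]; last first.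
  by rewrite face_flip //; apply: PF.
move=> ca cb; move: ab xy yz; move: ca cb; rewrite /corner3.
by case/or3P => /eqP ->; case/or3P => /eqP -> //; rewrite ?ltnn // ?Gxy ?Gyz ?Gxz //;
  clear; lia.
Qed.

End Sweep.

(** * Plane vectors and germs of curves *)

Section Plane.
Variable R : realType.
Implicit Types u v w x : plane R.

Definition px u : R := u.1.
Definition py u : R := u.2.

Lemma plane_ext u v : px u = px v -> py u = py v -> u = v.
Proof. by case: u v => [a b] [c d]; rewrite /px /py /= => -> ->. Qed.

Lemma pxD u v : px (u + v) = px u + px v. Proof. by []. Qed.
Lemma pyD u v : py (u + v) = py u + py v. Proof. by []. Qed.
Lemma pxN u : px (- u) = - px u. Proof. by []. Qed.
Lemma pyN u : py (- u) = - py u. Proof. by []. Qed.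
Lemma pxZ a u : px (a *: u) = a * px u. Proof. by []. Qed.
Lemma pyZ a u : py (a *: u) = a * py u. Proof. by []. Qed.
Lemma px0 : px 0 = 0. Proof. by []. Qed.
Lemma py0 : py 0 = 0. Proof. by []. Qed.
Definition planeE := (pxD, pyD, pxN, pyN, pxZ, pyZ, px0, py0).

(** The determinant of the two vectors: it is positive when [v] points to the left of
    [u]. *)
Definition cr u v : R := px u * py v - py u * px v.

Lemma crDl u v w : cr (u + v) w = cr u w + cr v w.
Proof. by rewrite /cr !planeE; ring. Qed.
Lemma crDr u v w : cr u (v + w) = cr u v + cr u w.
Proof. by rewrite /cr !planeE; ring. Qed.
Lemma crNl u v : cr (- u) v = - cr u v.
Proof. by rewrite /cr !planeE; ring. Qed.
Lemma crNr u v : cr u (- v) = - cr u v.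
Proof. by rewrite /cr !planeE; ring. Qed.
Lemma crZl a u v : cr (a *: u) v = a * cr u v.
Proof. by rewrite /cr !planeE; ring. Qed.
Lemma crZr a u v : cr u (a *: v) = a * cr u v.
Proof. by rewrite /cr !planeE; ring. Qed.
Lemma crvv u : cr u u = 0.
Proof. by rewrite /cr; ring. Qed.
Lemma crC u v : cr v u = - cr u v.
Proof. by rewrite /cr; ring. Qed.
Lemma cr0l u : cr 0 u = 0.
Proof. by rewrite /cr !planeE; ring. Qed.
Lemma cr0r u : cr u 0 = 0.
Proof. by rewrite /cr !planeE; ring. Qed.

Lemma cr_sumr (I : Type) (r : seq I) (P : pred I) (F : I -> plane R) u :
  cr u (\sum_(i <- r | P i) F i) = \sum_(i <- r | P i) cr u (F i).
Proof. by apply: (big_morph (cr u) (crDr u) (cr0r u)). Qed.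

Lemma cr_decomp u v x : cr u v != 0 ->
  x = (cr x v / cr u v) *: u + (cr u x / cr u v) *: v.
Proof. by move=> h; apply: plane_ext; rewrite !planeE /cr; field; exact: h. Qed.

End Plane.

(** A point infinitely close to [u] is represented by a curve [u + z d + z^2 d'] for small
    positive [z]. Its coordinates are polynomials of degree 2 in [z], which have a constant
    sign for small [z]: so it makes sense to say that it lies inside a tile. *)
Section Eventually.
Variable R : realFieldType.
Implicit Types P Q : R -> Prop.

Definition for_small P := exists2 d : R, 0 < d & forall z, 0 < z < d -> P z.

Lemma small_mono P Q : (forall z, 0 < z -> P z -> Q z) -> for_small P -> for_small Q.
Proof.
by move=> PQ [d d0 Pd]; exists d => // z /[dup] /andP[z0 _] /Pd; apply: PQ.
Qed.

Lemma small_and P Q : for_small P -> for_small Q -> for_small (fun z => P z /\ Q z).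
Proof.
move=> [d d0 Pd] [d' d'0 Qd]; exists (Num.min d d'); first by rewrite lt_min d0.
by move=> z; rewrite lt_min => /and3P[z0 zd zd']; split; [apply: Pd|apply: Qd];
  rewrite z0.
Qed.

Lemma small_true P : (forall z, 0 < z -> P z) -> for_small P.
Proof. by move=> h; exists 1 => // z /andP[/h]. Qed.

Lemma small_ex P : for_small P -> exists2 z, 0 < z & P z.
Proof.
move=> [d d0 Pd]; have h : 0 < d / 2 < d by apply/andP; split; lra.
by exists (d / 2); [case/andP: h | apply: Pd].
Qed.

Lemma small_all (I : finType) (P : I -> R -> Prop) :
  (forall i, for_small (P i)) -> for_small (fun z => forall i, P i z).
Proof.
move=> h.
have : for_small (fun z => forall i, i \in enum I -> P i z).
  elim: (enum I) => [|a s ih]; first exact: small_true.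
  apply: small_mono (small_and (h a) ih) => z _ [pa ps] i.
  by rewrite inE => /orP[/eqP ->|/ps].
by apply: small_mono => z _ hz i; apply: hz; rewrite mem_enum.
Qed.

Lemma small_lt (b : R) : 0 < b -> for_small (fun z => z < b).
Proof. by move=> b0; exists b => // z /andP[]. Qed.

(** Positivity of [a0 + a1 z + a2 z^2] at all small positive [z]. *)
Definition lexpos (a0 a1 a2 : R) :=
  (0 < a0) || (a0 == 0) && ((0 < a1) || (a1 == 0) && (0 < a2)).

Lemma small_lead (a0 a1 a2 : R) : 0 < a0 -> for_small (fun z => 0 < a0 + a1 * z + a2 * z ^+ 2).
Proof.
move=> a00.
pose m := `|a1| + `|a2| + 1.
have m0 : 0 < m by rewrite /m; have := normr_ge0 a1; have := normr_ge0 a2; lra.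
have am0 : 0 < a0 / m by apply: divr_gt0.
apply: small_mono (small_and (small_lt am0) (small_lt ltr01)) => z z0 [].
rewrite ltr_pdivlMr // => zm z1.
have h1 : `|a1 * z| <= `|a1| * z by rewrite normrM (gtr0_norm z0).
have h2 : `|a2 * z ^+ 2| <= `|a2| * z.
  rewrite normrM normrX (gtr0_norm z0) ler_wpM2l //.
  by rewrite expr2 ler_piMl // ltW.
move: h1 h2; rewrite !ler_norml => /andP[h1 _] /andP[h2 _].
have : z * m = `|a1| * z + `|a2| * z + z by rewrite /m; ring.
lra.
Qed.

Lemma small_lexpos (a0 a1 a2 : R) :
  lexpos a0 a1 a2 -> for_small (fun z => 0 < a0 + a1 * z + a2 * z ^+ 2).
Proof.
case/orP => [|/andP[/eqP ->]]; first exact: small_lead.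
case/orP => [a10|/andP[/eqP -> a20]].
- apply: small_mono (small_lead a2 0 a10) => z z0 h.
  have -> : 0 + a1 * z + a2 * z ^+ 2 = z * (a1 + a2 * z + 0 * z ^+ 2) by ring.
  exact: mulr_gt0.
- apply: small_true => z z0; rewrite mul0r !add0r; apply: mulr_gt0 => //.
  exact: exprn_gt0.
Qed.

Lemma lexpos_tri (a0 a1 a2 : R) :
  [\/ lexpos a0 a1 a2, lexpos (- a0) (- a1) (- a2) |
     [/\ a0 = 0, a1 = 0 & a2 = 0]].
Proof.
rewrite /lexpos !oppr_gt0 !oppr_eq0.
case: (ltrgtP 0 a0) => h0; [by constructor 1|by constructor 2|].
case: (ltrgtP 0 a1) => h1; [by constructor 1|by constructor 2|].
case: (ltrgtP 0 a2) => h2; [by constructor 1|by constructor 2|].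
by constructor 3.
Qed.

Lemma small_sign (a0 a1 a2 : R) :
  for_small (fun z => 0 <= a0 + a1 * z + a2 * z ^+ 2) \/
  for_small (fun z => ~~ (0 <= a0 + a1 * z + a2 * z ^+ 2)).
Proof.
case: (lexpos_tri a0 a1 a2) => [/small_lexpos h|/small_lexpos h|[-> -> ->]].
- by left; apply: small_mono h => z _ /ltW.
- by right; apply: small_mono h => z _ h; rewrite -ltNge; lra.
- by left; apply: small_true => z _; lra.
Qed.

Lemma small_ge0 (a0 a1 a2 : R) :
  for_small (fun z => 0 <= a0 + a1 * z + a2 * z ^+ 2) ->
  [|| lexpos a0 a1 a2 | [&& a0 == 0, a1 == 0 & a2 == 0]].
Proof.
move=> h; case: (lexpos_tri a0 a1 a2) => [->//|/small_lexpos h'|[-> -> ->]].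
  by have [z _ [h1 h2]] := small_ex (small_and h h'); lra.
by rewrite !eqxx orbT.
Qed.

Lemma small_ge0_const (a0 a1 a2 : R) :
  for_small (fun z => 0 <= a0 + a1 * z + a2 * z ^+ 2) -> 0 <= a0.
Proof.
move/small_ge0 => /orP[/orP[/ltW//|/andP[/eqP -> //]]|/and3P[/eqP -> //]].
Qed.

Lemma small_ge0_lin (a0 a1 a2 b : R) : a1 != 0 ->
  for_small (fun z => 0 <= a0 + a1 * z + a2 * z ^+ 2) ->
  for_small (fun z => 0 < a0 + a1 * z + b * z ^+ 2).
Proof.
move=> /negPf a1n /small_ge0; rewrite /lexpos a1n /= andbF !orbF => h.
by apply: small_lexpos; rewrite /lexpos a1n orbF.
Qed.

Definition in01 (a : R) := 0 <= a <= 1.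
Definition io01 (a : R) := 0 < a < 1.

Lemma small_in01P (a0 a1 a2 : R) :
  for_small (fun z => in01 (a0 + a1 * z + a2 * z ^+ 2)) ->
  for_small (fun z => 0 <= a0 + a1 * z + a2 * z ^+ 2) /\
  for_small (fun z => 0 <= (1 - a0) + (- a1) * z + (- a2) * z ^+ 2).
Proof.
by move=> h; split; apply: small_mono h => z _ /andP[h1 h2]; lra.
Qed.

Lemma small_io01 (a0 a1 a2 : R) :
  for_small (fun z => 0 < a0 + a1 * z + a2 * z ^+ 2) ->
  for_small (fun z => 0 < (1 - a0) + (- a1) * z + (- a2) * z ^+ 2) ->
  for_small (fun z => io01 (a0 + a1 * z + a2 * z ^+ 2)).
Proof.
move=> h h'; apply: small_mono (small_and h h') => z _ [h1 h2].
by apply/andP; split; lra.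
Qed.

Lemma small_in01_sign (a0 a1 a2 : R) :
  for_small (fun z => in01 (a0 + a1 * z + a2 * z ^+ 2)) \/
  for_small (fun z => ~~ in01 (a0 + a1 * z + a2 * z ^+ 2)).
Proof.
case: (small_sign a0 a1 a2) => h1; last first.
  by right; apply: small_mono h1 => z _ h; rewrite /in01 (negPf h).
case: (small_sign (1 - a0) (- a1) (- a2)) => h2; last first.
  by right; apply: small_mono h2 => z _; rewrite /in01 -!ltNge negb_and -!ltNge => h;
     apply/orP; right; lra.
by left; apply: small_mono (small_and h1 h2) => z _ [h h']; apply/andP; split; lra.
Qed.

(** When the linear term is nonzero, the quadratic term does not matter. *)
Lemma small_in01_open (a0 a1 a2 b : R) : a1 != 0 ->
  for_small (fun z => in01 (a0 + a1 * z + a2 * z ^+ 2)) ->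
  for_small (fun z => io01 (a0 + a1 * z + b * z ^+ 2)).
Proof.
move=> n1 /small_in01P[h1 h2]; apply: small_io01; first exact: small_ge0_lin h1.
by apply: small_ge0_lin h2; rewrite oppr_eq0.
Qed.

Lemma small_in01_const (a0 a1 a2 : R) :
  for_small (fun z => in01 (a0 + a1 * z + a2 * z ^+ 2)) -> in01 a0.
Proof.
by move=> /small_in01P[/small_ge0_const h1 /small_ge0_const h2]; apply/andP; split; lra.
Qed.

Lemma small_io01_const (a0 a1 a2 : R) : io01 a0 ->
  for_small (fun z => io01 (a0 + a1 * z + a2 * z ^+ 2)).
Proof.
by move=> /andP[h1 h2]; apply: small_io01; apply: small_lead; lra.
Qed.

End Eventually.

Lemma fin_ind (R : realType) (I : finType) (f : I -> R) (Q : I -> Prop) :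
  (forall i, (forall i', f i' < f i -> Q i') -> Q i) -> forall i, Q i.
Proof.
move=> h i; move: {2}_.+1 (ltnSn #|[set i' | f i' < f i]|) => N.
elim: N i => // N ih i le; apply: h => i' lt; apply: ih.
rewrite -ltnS; apply: leq_trans le; rewrite ltnS; apply/proper_card/properP.
split; first by apply/subsetP => j; rewrite !inE => h; apply: lt_trans lt.
by exists i'; rewrite !inE ?ltxx.
Qed.

(** * The polygon *)

Section Polygon.
Variables (R : realType) (n : nat).
Implicit Types (j k : 'I_n) (u v x : plane R).
Local Notation e := (@e R n).
Local Notation polygon := (@polygon R n).

(** All arguments on the directions [e j] use only that they turn to the left by less than
    a half-turn. *)
Lemma cr_e_gt0 j k : (j < k)%N -> 0 < cr (e j) (e k).
Proof.
move=> jk; have n0 : 0 < n%:R :> R by rewrite ltr0n; case: (n) j {jk k} => // -[].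
rewrite /cr /px /py /= mulrC (mulrC (sin _) (cos (pi * k%:R / _))).
have -> : forall a b : R, sin b * cos a - cos b * sin a = sin (b - a).
  by move=> a b; rewrite sinB.
apply: sin_gt0_pi.
have -> : pi * k%:R / n%:R - pi * j%:R / n%:R = pi * ((k - j)%:R / n%:R) :> R.
  by rewrite natrB ?(ltnW jk) //; field; rewrite gt_eqF.
have pi0 := pi_gt0 R; have kj0 : 0 < (k - j)%:R / n%:R :> R.
  by rewrite divr_gt0 // ltr0n subn_gt0.
rewrite mulr_gt0 //= gtr_pMr // ltr_pdivrMr // mul1r ltr_nat.
by have := ltn_ord k; lia.
Qed.

Lemma cr_e_neq0 j k : j != k -> cr (e j) (e k) != 0.
Proof.
rewrite -val_eqE /= neq_ltn => /orP[/cr_e_gt0/gt_eqF -> //|/cr_e_gt0 h].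
by rewrite crC oppr_eq0 gt_eqF.
Qed.

Lemma cr_e_sgn j k : j != k -> (0 < cr (e j) (e k)) = (j < k)%N.
Proof.
rewrite -val_eqE /= neq_ltn => /orP[jk|kj]; first by rewrite jk cr_e_gt0.
by rewrite crC oppr_gt0 (ltNge _ 0) ltW ?cr_e_gt0 // ltnNge ltnW.
Qed.

(** The coefficient of [e j] is the total weight of the sets that contain [j]. *)
Lemma poly_coefs x : polygon x ->
  exists2 a : 'I_n -> R, forall j, in01 (a j) & x = \sum_j a j *: e j.
Proof.
move=> [w [w0 w1 ->]]; exists (fun j => \sum_(S : {set 'I_n} | j \in S) w S).
  move=> j; rewrite /in01 sumr_ge0 //= -w1.
  by rewrite [leRHS](bigID (fun S : {set 'I_n} => j \in S)) /= lerDl sumr_ge0.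
under eq_bigr do rewrite scaler_sumr.
rewrite (exchange_big_dep xpredT) //=.
by apply: eq_bigr => j _; rewrite scaler_suml.
Qed.

Lemma poly_sum (S : {set 'I_n}) : polygon (\sum_(j in S) e j).
Proof.
exists (fun S' => (S' == S)%:R); split => [S'||]; first by rewrite ler0n.
  by rewrite (bigD1 S) //= eqxx big1 ?addr0 // => i /negPf ->.
by rewrite (bigD1 S) //= eqxx scale1r [X in _ + X]big1 ?addr0 // => i /negPf ->; rewrite scale0r.
Qed.

Lemma poly_conv x y t : in01 t -> polygon x -> polygon y ->
  polygon ((1 - t) *: x + t *: y).
Proof.
move=> /andP[t0 t1] [w [w0 w1 ->]] [w' [w'0 w'1 ->]].
exists (fun S => (1 - t) * w S + t * w' S); split.
- by move=> S; rewrite addr_ge0 // mulr_ge0 // subr_ge0.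
- by rewrite big_split /= -!mulr_sumr w1 w'1 !mulr1 subrK.
- rewrite !scaler_sumr; under [RHS]eq_bigr do rewrite scalerDl -!scalerA.
  by rewrite [RHS]big_split.
Qed.

(** A curve that leaves [u] in the direction [d] and bends towards [d']. *)
Definition germ u d d' (z : R) : plane R := u + z *: d + z ^+ 2 *: d'.

(** For small [z], the point is a convex combination of [u], [u + d] and [u + d']. *)
Lemma poly_germ u d d' : polygon u -> polygon (u + d) -> polygon (u + d') ->
  for_small (fun z => polygon (germ u d d' z)).
Proof.
move=> pu pd pd'; exists (1/2); first lra.
move=> z /andP[z0 z1].
have z2 : 0 < z ^+ 2 by rewrite exprn_gt0.
have z3 : z ^+ 2 < 1/4 by nra.
have h1 : in01 (z / (1 - z ^+ 2)).
  rewrite /in01 divr_ge0 ?ler_pdivrMr //=; lra.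
have h2 : in01 (z ^+ 2) by rewrite /in01; lra.
have := poly_conv h2 (poly_conv h1 pu pd) pd'.
congr polygon; rewrite /germ; apply: plane_ext; rewrite !planeE; field; lra.
Qed.

(** The left boundary of the polygon goes from [tail n = 0] to [tail 0] through these
    corners; its side parallel to [e j] goes from [tail j.+1] to [tail j]. *)
Definition tail (m : nat) : plane R := \sum_(k < n | (m <= k)%N) e k.

Lemma tail_poly m : polygon (tail m).
Proof.
have := poly_sum [set k : 'I_n | (m <= k)%N]; congr polygon.
by apply: eq_bigl => k; rewrite inE.
Qed.

Lemma tailS j : tail j = tail j.+1 + e j.
Proof.
rewrite /tail (bigD1 j) //= addrC; congr (_ + _); apply: eq_bigl => k.
by rewrite ltn_neqAle eq_sym andbC.
Qed.

Lemma tail_n : tail n = 0.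
Proof. by rewrite /tail big1 // => k; rewrite leqNgt ltn_ord. Qed.

(** The maximum of [cr (e j)] forces the coefficients of the other directions. *)
Lemma poly_side j x : polygon x -> cr (e j) (tail j.+1) <= cr (e j) x ->
  exists2 t, in01 t & x = tail j.+1 + t *: e j.
Proof.
move=> /poly_coefs[a a01 ->] le; exists (a j) => //.
have crx : cr (e j) (\sum_k a k *: e k) = \sum_k a k * cr (e j) (e k).
  by rewrite cr_sumr; apply: eq_bigr => k _; rewrite crZr.
have crt : cr (e j) (tail j.+1) = \sum_(k < n) (j < k)%N%:R * cr (e j) (e k).
  rewrite /tail cr_sumr big_mkcond /=; apply: eq_bigr => k _.
  by case: ltnP; rewrite (mul1r, mul0r).
have pos (k : 'I_n) : 0 <= ((j < k)%N%:R - a k) * cr (e j) (e k).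
  have /andP[a0 a1] := a01 k; case: (ltngtP j k) => [jk|kj|/val_inj ->].
  - by rewrite mulr_ge0 ?(ltW (cr_e_gt0 jk)) // subr_ge0.
  - by rewrite crC mulrN -mulNr opprB subr0 mulr_ge0 ?(ltW (cr_e_gt0 kj)).
  - by rewrite crvv mulr0.
have sum0 : \sum_(k < n) ((j < k)%N%:R - a k) * cr (e j) (e k) = 0.
  apply/eqP; rewrite eq_le sumr_ge0 // andbT.
  under eq_bigr do rewrite mulrBl.
  by rewrite sumrB -crt -crx subr_le0.
have ak (k : 'I_n) : k != j -> a k = (j < k)%N%:R.
  move=> kj; have := psumr_eq0P (fun i _ => pos i) sum0 (i := k) isT.
  have jk : j != k by rewrite eq_sym.
  move/eqP; rewrite mulf_eq0 (negPf (cr_e_neq0 jk)) orbF.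
  by rewrite subr_eq0 => /eqP ->.
rewrite (bigD1 j) //= addrC /tail; congr (_ + _).
rewrite [RHS]big_mkcond /= [LHS]big_mkcond; apply: eq_bigr => k _.
case: eqVneq => [->|kj] /=; first by rewrite ltnn.
by rewrite ak //; case: ltnP; rewrite (scale1r, scale0r).
Qed.

(** A side of the polygon has the length of [e j], so that a side of a tile fills it. *)
Lemma poly_side_edge j u : polygon u -> polygon (u + e j) ->
  cr (e j) (tail j.+1) <= cr (e j) u -> u = tail j.+1.
Proof.
move=> pu pue le.
have [t /andP[t0 t1] ut] := poly_side pu le.
have [|t' /andP[t'0 t'1] ut'] := poly_side pue (j := j); first by rewrite crDr crvv addr0.
move: ut'; rewrite ut -addrA -[X in _ + X = _]/(t *: e j + e j) => /addrI.
rewrite -[X in _ + X = _]scale1r -scalerDl => /eqP; rewrite -subr_eq0 -scalerBl.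
rewrite scaler_eq0 => /orP[/eqP h|/eqP ej0].
  have -> : t = 0 by lra.
  by rewrite scale0r addr0.
by rewrite ej0 scaler0 addr0.
Qed.

Section Height.
Hypothesis n_ge2 : (2 <= n)%N.

Definition first_ord : 'I_n := Ordinal (leq_trans (isT : (0 < 2)%N) n_ge2).
Definition last_ord : 'I_n := rev_ord first_ord.

(** A linear form that is positive on all the [e j]. *)
Definition height x : R := cr (e first_ord) x + cr x (e last_ord).

Lemma heightD x y : height (x + y) = height x + height y.
Proof. by rewrite /height crDr crDl; ring. Qed.
Lemma heightZ a x : height (a *: x) = a * height x.
Proof. by rewrite /height crZr crZl; ring. Qed.
Lemma heightN x : height (- x) = - height x.
Proof. by rewrite /height crNr crNl; ring. Qed.
Lemma height0 : height 0 = 0.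
Proof. by rewrite /height cr0r cr0l addr0. Qed.

Lemma height_e j : 0 < height (e j).
Proof.
rewrite /height; case: (posnP j) => [j0|j0].
  have -> : j = first_ord by apply: val_inj.
  by rewrite crvv add0r cr_e_gt0 //= subn1; lia.
apply: ltr_wpDr; last exact: cr_e_gt0.
case: (eqVneq j last_ord) => [->|jl]; first by rewrite crvv.
apply/ltW/cr_e_gt0; move: jl; rewrite -val_eqE /= => jl.
by have := ltn_ord j; lia.
Qed.

End Height.
End Polygon.

(** * Tiles and their sides *)

Section Coordinates.
Variables (R : realType) (n : nat).
Implicit Types (j k : 'I_n) (u v x d : plane R) (s : bool).
Local Notation e := (@e R n).

(** The coordinate of [x] along [e j] in the basis [e j], [e k]. *)
Definition co j k x : R := cr x (e k) / cr (e j) (e k).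

Lemma coD j k x y : co j k (x + y) = co j k x + co j k y.
Proof. by rewrite /co crDl mulrDl. Qed.
Lemma coZ j k a x : co j k (a *: x) = a * co j k x.
Proof. by rewrite /co crZl mulrA. Qed.
Lemma coN j k x : co j k (- x) = - co j k x.
Proof. by rewrite /co crNl mulNr. Qed.
Lemma co0 j k : co j k 0 = 0.
Proof. by rewrite /co cr0l mul0r. Qed.
Lemma co1 j k : j != k -> co j k (e j) = 1.
Proof. by move=> jk; rewrite /co divff ?cr_e_neq0. Qed.
Lemma co_other j k : co j k (e k) = 0.
Proof. by rewrite /co crvv mul0r. Qed.

Lemma co_decomp j k x : j != k -> x = co j k x *: e j + co k j x *: e k.
Proof.
move=> jk; rewrite [LHS](cr_decomp x (cr_e_neq0 R jk)) /co; congr (_ + _ *: _).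
by rewrite (crC (e j) x) (crC (e j) (e k)); field; rewrite ?oppr_eq0 cr_e_neq0.
Qed.

(** The direction in which a side parallel to [e k] leaves a corner of a tile, and the
    position of this corner relative to the lowest one. *)
Definition dir s k : plane R := if s then e k else - e k.
Definition off s k : plane R := if s then 0 else e k.

Lemma dirE s k : dir s k = (if s then 1 else -1) *: e k.
Proof. by case: s; rewrite /dir ?scale1r ?scaleN1r. Qed.

Lemma cr_dir_neq0 j k s : j != k -> cr (e j) (dir s k) != 0.
Proof. by move=> jk; case: s; rewrite /= ?crNr ?oppr_eq0 cr_e_neq0. Qed.

Lemma dirN s k : dir (~~ s) k = - dir s k.
Proof. by case: s; rewrite /= ?opprK. Qed.

Lemma off_dir s k : off s k + dir s k = off (~~ s) k.
Proof. by case: s; rewrite /= ?add0r ?subrr. Qed.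

End Coordinates.

Section Tiles.
Variables (R : realType) (n : nat) (T : tiling R n).
Implicit Types (j k : 'I_n) (u v x d : plane R) (s : bool).
Local Notation e := (@e R n).
Local Notation co := (@co R n).
Local Notation dir := (@dir R n).
Local Notation off := (@off R n).
Local Notation polygon := (@polygon R n).

(** The lowest corner of the tile with sides parallel to [e j] and [e k]. *)
Definition base j k := if (j < k)%N then pos T j k else pos T k j.

Lemma baseC j k : base j k = base k j.
Proof.
by rewrite /base; case: ltngtP => // /val_inj ->.
Qed.

Definition tile j k x :=
  in01 (co j k (x - base j k)) && in01 (co k j (x - base j k)).
Definition open_tile j k x :=
  io01 (co j k (x - base j k)) && io01 (co k j (x - base j k)).

Lemma tileC j k x : tile j k x = tile k j x.
Proof. by rewrite /tile andbC baseC. Qed.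

Lemma co_sum j k a b : j != k ->
  co j k (a *: e j + b *: e k) = a /\ co k j (a *: e j + b *: e k) = b.
Proof.
move=> jk; have kj : k != j by rewrite eq_sym.
by rewrite !coD !coZ !co_other !co1 // !mulr0 !mulr1 addr0 add0r.
Qed.

Lemma tile_rhombus j k x : (j < k)%N ->
  tile j k x <-> rhombus j k (pos T j k) x.
Proof.
move=> jk; have jkn : j != k by rewrite -val_eqE neq_ltn jk.
rewrite /tile /rhombus /base jk; split => [/andP[h1 h2]|[a [b [ha hb ->]]]].
  exists (co j k (x - pos T j k)), (co k j (x - pos T j k)); split => //.
  by rewrite -addrA -co_decomp // addrC subrK.
have -> : pos T j k + a *: e j + b *: e k - pos T j k = a *: e j + b *: e k.
  by apply: plane_ext; rewrite !planeE; ring.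
by have [-> ->] := co_sum a b jkn; apply/andP.
Qed.

Lemma open_tile_rhombus j k x : (j < k)%N ->
  open_tile j k x -> rhombus_int j k (pos T j k) x.
Proof.
move=> jk; have jkn : j != k by rewrite -val_eqE neq_ltn jk.
rewrite /open_tile /rhombus_int /base jk => /andP[h1 h2].
exists (co j k (x - pos T j k)), (co k j (x - pos T j k)); split => //.
by rewrite -addrA -co_decomp // addrC subrK.
Qed.

Lemma open_tileC j k x : open_tile j k x = open_tile k j x.
Proof. by rewrite /open_tile andbC baseC. Qed.

Lemma tile_polygon j k x : j != k -> tile j k x -> polygon x.
Proof.
rewrite -val_eqE /= neq_ltn => /orP[jk|kj] h; apply/(tiling_cover T).
  by exists j, k; split => //; apply/tile_rhombus.
by exists k, j; split => //; apply/tile_rhombus => //; rewrite tileC.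
Qed.

Lemma polygon_tile x : polygon x -> exists j k, (j < k)%N /\ tile j k x.
Proof.
by move=> /(tiling_cover T)[j [k [jk h]]]; exists j, k; split=> //; apply/tile_rhombus.
Qed.

Definition same_pair j k j' k' := j = j' /\ k = k' \/ j = k' /\ k = j'.

Lemma open_tile_uniq j k j' k' x : j != k -> j' != k' ->
  open_tile j k x -> open_tile j' k' x -> same_pair j k j' k'.
Proof.
move=> jk jk' h h'.
wlog lt : j k jk h / (j < k)%N.
  move=> H; move: (jk); rewrite -val_eqE /= neq_ltn => /orP[|kj]; first exact: H.
  have [| | |[-> ->]|[-> ->]] // := H k j; rewrite 1?eq_sym //.
  - by rewrite open_tileC.
  - by right.
  - by left.
wlog lt' : j' k' jk' h' / (j' < k')%N.
  move=> H; move: (jk'); rewrite -val_eqE /= neq_ltn => /orP[|kj]; first exact: H.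
  have [| | |[-> ->]|[-> ->]] // := H k' j'; rewrite 1?eq_sym //.
  - by rewrite open_tileC.
  - by right.
  - by left.
by left; apply: tiling_disjoint (open_tile_rhombus lt h) (open_tile_rhombus lt' h').
Qed.

(** The tile with sides [e j], [e k] has the corner [v], from which its sides
    leave in the directions [dir sj j] and [dir sk k]. *)
Definition corner v j sj k sk := j != k /\ v = base j k + off sj j + off sk k.

Lemma corner_sym v j sj k sk : corner v j sj k sk -> corner v k sk j sj.
Proof.
by move=> [jk ->]; split; [rewrite eq_sym | rewrite baseC addrAC].
Qed.

Lemma corner_move v j sj k sk : corner v j sj k sk ->
  corner (v + dir sj j) j (~~ sj) k sk.
Proof.
move=> [jk ->]; split => //; rewrite -addrA (addrC (off sk k)) addrA.
by rewrite -(addrA (base j k)) off_dir.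
Qed.

Lemma corner_edge v j sj k sk : corner v j sj k sk -> corner (v - off sj j) j true k sk.
Proof.
by move=> [jk ->]; split => //; rewrite addr0 addrAC addrK.
Qed.

Lemma io01_flip (a : R) : io01 (1 - a) = io01 a.
Proof. by rewrite /io01 andbC subr_gt0 gtrBl. Qed.
Lemma in01_flip (a : R) : in01 (1 - a) = in01 a.
Proof. by rewrite /in01 andbC subr_ge0 gerBl. Qed.

Lemma io01_side s (a : R) :
  io01 ((if s then 0 else 1) + a) = io01 ((if s then 1 else -1) * a).
Proof.
case: s; first by rewrite add0r mul1r.
by rewrite -[RHS]io01_flip mulN1r opprK.
Qed.

Lemma in01_side s (a : R) :
  in01 ((if s then 0 else 1) + a) = in01 ((if s then 1 else -1) * a).
Proof.
case: s; first by rewrite add0r mul1r.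
by rewrite -[RHS]in01_flip mulN1r opprK.
Qed.

Lemma corner_co v j sj k sk x : corner v j sj k sk ->
  co j k (v + x - base j k) = (if sj then 0 else 1) + co j k x.
Proof.
move=> [jk ->].
have -> : base j k + off sj j + off sk k + x - base j k = off sj j + off sk k + x.
  by apply: plane_ext; rewrite !planeE; ring.
by rewrite !coD /off; case: sj; case: sk; rewrite ?co0 ?co1 ?co_other // ?addr0.
Qed.

(** The coordinate of [x] along [dir sj j] in the basis [dir sj j], [dir sk k], for
    either value of [sk]. *)
Definition cco sj j k x : R := (if sj then 1 else -1) * co j k x.

Lemma corner_open v j sj k sk x : corner v j sj k sk ->
  open_tile j k (v + x) = io01 (cco sj j k x) && io01 (cco sk k j x).
Proof.
move=> c; rewrite /open_tile (corner_co _ c) baseC (corner_co _ (corner_sym c)).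
by rewrite !io01_side.
Qed.

Lemma corner_closed v j sj k sk x : corner v j sj k sk ->
  tile j k (v + x) = in01 (cco sj j k x) && in01 (cco sk k j x).
Proof.
move=> c; rewrite /tile (corner_co _ c) baseC (corner_co _ (corner_sym c)).
by rewrite !in01_side.
Qed.

Lemma in01_0 : in01 (0 : R). Proof. by rewrite /in01 lexx ler01. Qed.

Lemma corner_polygon v j sj k sk : corner v j sj k sk -> polygon v.
Proof.
move=> c; apply: (@tile_polygon j k); first by case: c.
by rewrite -[v]addr0 (corner_closed _ c) /cco !co0 !mulr0 in01_0.
Qed.

Lemma cco_dir sj j k : j != k -> cco sj j k (dir sj j) = 1.
Proof. by move=> jk; rewrite /cco; case: sj; rewrite /= ?coN co1 //; lra. Qed.
Lemma cco_dir_other sj j k s : cco sj j k (dir s k) = 0.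
Proof. by rewrite /cco; case: s; rewrite /= ?coN co_other; lra. Qed.
Lemma ccoD s j k x y : cco s j k (x + y) = cco s j k x + cco s j k y.
Proof. by rewrite /cco coD; ring. Qed.
Lemma ccoZ s j k a x : cco s j k (a *: x) = a * cco s j k x.
Proof. by rewrite /cco coZ; ring. Qed.

Lemma cco_germ s j k d d' z :
  cco s j k (z *: d + z ^+ 2 *: d') = 0 + cco s j k d * z + cco s j k d' * z ^+ 2.
Proof. by rewrite ccoD !ccoZ; ring. Qed.

Lemma cco_decomp sj j sk k x : j != k ->
  x = cco sj j k x *: dir sj j + cco sk k j x *: dir sk k.
Proof.
move=> jk; rewrite [LHS](co_decomp x jk) /cco !dirE !scalerA.
by case: sj; case: sk; congr (_ *: _ + _ *: _); lra.
Qed.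

Lemma co_germ j k u d d' z t :
  co j k (germ u d d' z - t) = co j k (u - t) + co j k d * z + co j k d' * z ^+ 2.
Proof. by rewrite /germ !coD !coZ; ring. Qed.

(** The finitely many tiles cover the polygon, and each of them contains the curve for all
    small [z] or for none. *)
Lemma germ_in_tile u d d' :
  polygon u -> polygon (u + d) -> polygon (u + d') ->
  exists j k, j != k /\ for_small (fun z => tile j k (germ u d d' z)).
Proof.
move=> pu pd pd'; apply: contrapT => no.
have out (i : 'I_n * 'I_n) : for_small (fun z => i.1 != i.2 -> ~~ tile i.1 i.2 (germ u d d' z)).
  case: i => j k /=; case: (eqVneq j k) => [_|jk]; first exact: small_true.
  set p := base j k.
  case: (small_in01_sign (co j k (u - p)) (co j k d) (co j k d')) => h1; last first.
    by apply: small_mono h1 => z _ h _; rewrite /tile co_germ (negPf h).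
  case: (small_in01_sign (co k j (u - p)) (co k j d) (co k j d')) => h2; last first.
    by apply: small_mono h2 => z _ h _; rewrite /tile !co_germ (negPf h) andbF.
  case: no; exists j, k; split => //.
  by apply: small_mono (small_and h1 h2) => z _ [a b]; rewrite /tile !co_germ a.
have [z z0 [pz outz]] := small_ex (small_and (poly_germ pu pd pd') (small_all out)).
have [j [k [jk tz]]] := polygon_tile pz.
have := outz (j, k); rewrite /= tz -val_eqE neq_ltn jk => /(_ isT).
by [].
Qed.

End Tiles.

Section Matching.
Variables (R : realType) (n : nat) (T : tiling R n).
Implicit Types (j k : 'I_n) (u v x d : plane R) (s : bool).
Local Notation e := (@e R n).
Local Notation co := (@co R n).
Local Notation cco := (@cco R n).
Local Notation dir := (@dir R n).
Local Notation off := (@off R n).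
Local Notation polygon := (@polygon R n).
Local Notation base := (base T).
Local Notation corner := (corner T).
Local Notation tile := (tile T).
Local Notation open_tile := (open_tile T).

Lemma small_io01_0 (a1 a2 : R) : lexpos 0 a1 a2 ->
  for_small (fun z => io01 (0 + a1 * z + a2 * z ^+ 2)).
Proof.
by move=> h; apply: small_io01; [exact: small_lexpos | apply: small_lead; rewrite subr0 ltr01].
Qed.

Lemma lexpos1 (a b : R) : 0 < a -> lexpos 0 a b.
Proof. by move=> a0; rewrite /lexpos (eqxx (0 : R)) a0 orbT. Qed.
Lemma lexpos2 (a b : R) : a = 0 -> 0 < b -> lexpos 0 a b.
Proof. by move=> -> b0; rewrite /lexpos (eqxx (0 : R)) b0 !orbT. Qed.

Lemma germ_corner v j sj k sk d d' : corner v j sj k sk ->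
  lexpos 0 (cco sj j k d) (cco sj j k d') ->
  lexpos 0 (cco sk k j d) (cco sk k j d') ->
  for_small (fun z => open_tile j k (germ v d d' z)).
Proof.
move=> c /small_io01_0 h1 /small_io01_0 h2; apply: small_mono (small_and h1 h2) => z _ [h h'].
by rewrite /germ -addrA (corner_open _ c) !cco_germ h.
Qed.

Lemma cr_cco j k s x : j != k ->
  cr (e j) x = cco s k j x * cr (e j) (dir s k).
Proof.
move=> jk; rewrite {1}(cco_decomp true s x jk) crDr !crZr /= crvv mulr0 add0r //.
Qed.

(** A germ that leaves [u] along its side [e j] and bends into the tile. *)
Lemma germ_side u j k s : corner u j true k s ->
  for_small (fun z => open_tile j k (germ u (e j) (dir s k) z)).
Proof.
move=> c; have [jk _] := c; have kj : k != j by rewrite eq_sym.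
apply: (germ_corner c); rewrite -[e j]/(dir true j).
  by apply: lexpos1; rewrite cco_dir.
by apply: lexpos2; rewrite ?cco_dir_other // cco_dir.
Qed.

(** Tiles on the same side of a line, with overlapping sides on this line, share a germ
    that follows the common part and bends into both. *)
Lemma edge_overlap u u' j k s k' s' t : corner u j true k s -> corner u' j true k' s' ->
  0 < cr (e j) (dir s k) * cr (e j) (dir s' k') -> u = u' + t *: e j -> 0 <= t < 1 ->
  [/\ k = k', s = s' & u = u'].
Proof.
move=> c c' same uu' /andP[t0 t1].
have [jk ub] := c; have [jk' ub'] := c'.
have kj' : k' != j by rewrite eq_sym.
suff kk' : k = k'.
  have ss' : s = s'.
    rewrite kk' in same; move: same; case: (s); case: (s') => //=; rewrite crNr;
    rewrite ?mulrN ?mulNr oppr_gt0 -expr2 ltNge sqr_ge0 //.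
  by split => //; rewrite ub ub' kk' ss'.
have pos : 0 < cco s' k' j (dir s k).
  move: same; rewrite (cr_cco s' (dir s k) jk') -mulrA -expr2.
  by rewrite pmulr_lgt0 // exprn_even_gt0 //= cr_dir_neq0.
have h := germ_side c.
have h' : for_small (fun z => open_tile j k' (germ u (e j) (dir s k) z)).
  have h1 : for_small (fun z => io01 (t + 1 * z + cco true j k' (dir s k) * z ^+ 2)).
    apply: small_io01; last by apply: small_lead; lra.
    move: t0; rewrite le_eqVlt => /orP[/eqP <-|t0]; last exact: small_lead.
    by apply: small_lexpos; apply: lexpos1.
  have h2 : for_small (fun z => io01 (0 + 0 * z + cco s' k' j (dir s k) * z ^+ 2)).
    by apply: small_io01_0; apply: lexpos2.
  apply: small_mono (small_and h1 h2) => z _ [H1 H2].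
  rewrite /germ uu'.
  have -> : u' + t *: e j + z *: e j + z ^+ 2 *: dir s k =
     u' + ((t + z) *: dir true j + z ^+ 2 *: dir s k).
    by apply: plane_ext; rewrite !planeE /=; ring.
  rewrite (corner_open _ c') !ccoD !ccoZ (cco_dir R true jk') cco_dir_other.
  rewrite mulr0 mulr1.
  have -> : t + z + z ^+ 2 * cco true j k' (dir s k) =
    t + 1 * z + cco true j k' (dir s k) * z ^+ 2 by ring.
  have -> : 0 + z ^+ 2 * cco s' k' j (dir s k) =
    0 + 0 * z + cco s' k' j (dir s k) * z ^+ 2 by ring.
  by rewrite H1.
have [z _ [H H']] := small_ex (small_and h h').
by have [[_ ->]|[jk'' ->]] := open_tile_uniq jk jk' H H'; last rewrite jk'' eqxx in jk'.
Qed.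

(** A point [u + d] of the polygon beyond a side of a tile makes room for a tile
    there. The germ that follows the side and bends towards [u + d] lies in some tile. If
    this tile had no side on the line, it would also contain the germ that bends
    the other way, and overlap the given tile. *)
Lemma edge_opposite u j k s d : corner u j true k s -> polygon (u + d) ->
  cr (e j) (dir s k) * cr (e j) d < 0 ->
  exists t k' s', [/\ 0 <= t < 1, corner (u - t *: e j) j true k' s' &
    0 < cr (e j) (dir s' k') * cr (e j) d].
Proof.
move=> c pd opp; have [jk ub] := c.
have pu := corner_polygon c.
have pe : polygon (u + e j) := corner_polygon (corner_move c).
have [a [b [ab tab]]] := germ_in_tile T pu pe pd.
have hside := germ_side c.
have clash : for_small (fun z => open_tile a b (germ u (e j) (dir s k) z)) -> same_pair j k a b.
  move=> h; have [z _ [H H']] := small_ex (small_and hside h).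
  exact: open_tile_uniq H H'.
have h1 : for_small (fun z => in01 (co a b (u - base a b) + co a b (e j) * z + co a b d * z ^+ 2)).
  by apply: small_mono tab => z _ /andP[]; rewrite co_germ.
have h2 : for_small (fun z => in01 (co b a (u - base a b) + co b a (e j) * z + co b a d * z ^+ 2)).
  by apply: small_mono tab => z _ /andP[_]; rewrite co_germ.
case: (boolP ((j == a) || (j == b))) => [jab|]; last first.
  rewrite negb_or => /andP[ja jb].
  have n1 : co a b (e j) != 0.
    by rewrite /co mulf_neq0 ?invr_neq0 // cr_e_neq0.
  have n2 : co b a (e j) != 0.
    by rewrite /co mulf_neq0 ?invr_neq0 // cr_e_neq0 // eq_sym.
  have /clash [[E _]|[E _]] : for_small (fun z => open_tile a b (germ u (e j) (dir s k) z)).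
  - have H1 := small_in01_open (co a b (dir s k)) n1 h1.
    have H2 := small_in01_open (co b a (dir s k)) n2 h2.
    by apply: small_mono (small_and H1 H2) => z _ [A B]; rewrite /open_tile !co_germ A.
  - by rewrite E eqxx in ja.
  - by rewrite E eqxx in jb.
wlog E : a b ab tab clash h1 h2 jab / j = a.
  move=> H; case/orP: (jab) => /eqP E; first exact: (H a b).
  apply: (H b a) => //; rewrite 1?eq_sym //.
  - by apply: small_mono tab => z _; rewrite tileC.
  - move=> h; have h' : for_small (fun z => open_tile a b (germ u (e j) (dir s k) z)).
      by apply: small_mono h => z _; rewrite open_tileC.
    by have [[-> ->]|[-> ->]] := clash h'; [right | left].
  - by rewrite baseC.
  - by rewrite baseC.
  - by rewrite E eqxx.
subst a; rewrite co1 // in h1; rewrite co_other in h2.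
set t := co j b (u - base j b) in h1; set r := co b j (u - base j b) in h2.
have bj : b != j by rewrite eq_sym.
have dn0 : cr (e j) d != 0.
  by apply/eqP => d0; rewrite d0 mulr0 ltxx in opp.
have t01 : 0 <= t < 1.
  have /andP[-> t1] := small_in01_const h1; rewrite lt_neqAle t1 andbT /=.
  apply/eqP => t1'; rewrite t1' in h1.
  have [_ /small_ge0] := small_in01P h1.
  by rewrite /lexpos subrr ltxx oppr_gt0 ltr10 oppr_eq0 oner_eq0 /= !andbF.
have ud : u = base j b + t *: e j + r *: e b.
  by rewrite -addrA -co_decomp // addrC subrK.
have crd : cr (e j) d = co b j d * cr (e j) (e b).
  by have := cr_cco true d ab; rewrite /cco mul1r.
have r01 := small_in01_const h2.
(* [r] tells where the line lies in the new tile: on one of its sides or, for [rin],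
   inside it, which makes the new tile overlap the given one. *)
have [r0|[r1|rin]] : r = 0 \/ r = 1 \/ io01 r.
  case/andP: r01; rewrite le_eqVlt => /orP[/eqP <-|r0]; first by left.
  rewrite le_eqVlt => /orP[/eqP ->|r1]; first by right; left.
  by right; right; rewrite /io01 r0.
- exists t, b, true; split => //.
    by split => //; rewrite ud r0 scale0r /off !addr0 addrK.
  have [/small_ge0 + _] := small_in01P h2.
  rewrite /lexpos r0 eqxx ltxx /= => /orP[pos|/eqP z].
    rewrite /= crd mulrCA pmulr_rgt0 // -expr2 exprn_even_gt0 //=.
    by rewrite cr_e_neq0.
  by rewrite crd z mul0r eqxx in dn0.
- exists t, b, false; split => //.
    by split => //; rewrite ud r1 scale1r /off !addr0 addrAC addrK.
  have [_ /small_ge0] := small_in01P h2.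
  rewrite /lexpos r1 subrr oppr0 eqxx ltxx /= oppr_gt0 oppr_eq0 => /orP[neg|/eqP z].
    rewrite /= crd crNr mulNr mulrCA oppr_gt0 nmulr_rlt0 // -expr2 exprn_even_gt0 //=.
    by rewrite cr_e_neq0.
  by rewrite crd z mul0r eqxx in dn0.
- have /clash[[_ kb]|[jb _]] : for_small (fun z => open_tile j b (germ u (e j) (dir s k) z)).
  + have H1 := small_in01_open (co j b (dir s k)) (oner_neq0 _) h1.
    have H2 := small_io01_const 0 (co b j (dir s k)) rin.
    apply: small_mono (small_and H1 H2) => z _ [A B].
    by rewrite /open_tile !co_germ co1 // A co_other B.
  + subst b; move: rin.
    have -> : r = (if s then 0 else 1).
      rewrite /r -[u]addr0 baseC (corner_co _ (corner_sym c)) co0 addr0 //.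
    by case: (s); rewrite /io01 ltxx ?andbF.
  + by rewrite jb eqxx in ab.
Qed.

End Matching.

(** * Sides, vertices and walks *)

Section Graph.
Variables (R : realType) (n : nat) (n_ge2 : (2 <= n)%N) (T : tiling R n).
Implicit Types (j k : 'I_n) (u v x d : plane R) (s : bool).
Local Notation e := (@e R n).
Local Notation co := (@co R n).
Local Notation cco := (@cco R n).
Local Notation dir := (@dir R n).
Local Notation off := (@off R n).
Local Notation polygon := (@polygon R n).
Local Notation base := (base T).
Local Notation corner := (corner T).
Local Notation tile := (tile T).
Local Notation open_tile := (open_tile T).
Local Notation tail := (@tail R n).
Local Notation height := (@height R n n_ge2).
Local Notation edge := (tiling_edge T).
Local Notation vertex := (vertex T).

(** By [edge_opposite] a side overlaps a side of a tile beyond it, which starts at the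
    same height or lower. If lower, this side is matched by induction on the height, and
    its partner overlaps the given side. *)
Lemma edge_match u j k s d : corner u j true k s -> polygon (u + d) ->
  cr (e j) (dir s k) * cr (e j) d < 0 ->
  exists k' s', corner u j true k' s' /\ 0 < cr (e j) (dir s' k') * cr (e j) d.
Proof.
move=> c; have ub : u = base j (k, s).1 + off (k, s).2 (k, s).1.
  by have [_ ->] := c; rewrite addr0.
move: c; rewrite -[X in corner _ _ _ X]/(k, s).1 -[X in corner _ _ _ _ X]/(k, s).2.
rewrite -[X in dir X]/(k, s).2 -[X in dir _ X]/(k, s).1.
move: (k, s) ub => {k s} ks.
elim/(@fin_ind R _ (fun ks : 'I_n * bool => height (base j ks.1 + off ks.2 ks.1))): ks u d.
move=> [k s] IH u d /= ub c pd opp; have [jk _] := c.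
have [t [k' [s' [t01 c' side]]]] := edge_opposite c pd opp.
(* The overlapping side starts [t] sides lower on the line. *)
case: (eqVneq t 0) => [t0|tn0].
  by exists k', s'; split => //; move: c'; rewrite t0 scale0r subr0.
have t0 : 0 < t by rewrite lt_neqAle eq_sym tn0; case/andP: t01.
have u'b : u - t *: e j = base j k' + off s' k' by have [_ ->] := c'; rewrite addr0.
have lower : height (base j k' + off s' k') < height (base j k + off s k).
  by rewrite -u'b -ub heightD heightN heightZ gtrDl oppr_lt0 mulr_gt0 ?height_e.
pose d' := t *: e j + dir s k.
have d'P : polygon (u - t *: e j + d').
  rewrite /d' addrA subrK; exact: corner_polygon (corner_move (corner_sym c)).
have crd' : cr (e j) d' = cr (e j) (dir s k) by rewrite /d' crDr crZr crvv mulr0 add0r.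
have dn0 : 0 < cr (e j) d ^+ 2.
  rewrite exprn_even_gt0 //=; apply/eqP => h; by rewrite h mulr0 ltxx in opp.
have opp' : cr (e j) (dir s' k') * cr (e j) d' < 0.
  rewrite crd' -(pmulr_llt0 _ dn0).
  have -> : forall a b c : R, a * b * c ^+ 2 = (a * c) * (b * c) by move=> *; ring.
  by rewrite (pmulr_rlt0 _ side).
have [k2 [s2 [c2 side2]]] := IH (k', s') lower _ _ u'b c' d'P opp'.
rewrite crd' in side2.
have uu : u = u - t *: e j + t *: e j by rewrite subrK.
have same : 0 < cr (e j) (dir s k) * cr (e j) (dir s2 k2) by rewrite mulrC.
have [_ _ /eqP] := edge_overlap c c2 same uu t01.

rewrite -subr_eq0 opprB addrC subrK scaler_eq0 (negPf tn0) /= => /eqP ej0.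
by have := height_e R n_ge2 j; rewrite ej0 height0 ltxx.
Qed.

Lemma edgeP u j : edge u j <-> exists k s, corner u j true k s.
Proof.
split.
  move=> [a [b [ab]]] /=; have abn : a != b by rewrite -val_eqE neq_ltn ab.
  have ban : b != a by rewrite eq_sym.
  have bab : base a b = pos T a b by rewrite /base ab.
  have bba : base b a = pos T a b by rewrite baseC.
  move=> [[-> [->|->]]|[-> [->|->]]].
  - by exists b, true; split => //; rewrite bab !addr0.
  - by exists b, false; split => //; rewrite bab !addr0.
  - by exists a, true; split => //; rewrite bba !addr0.
  - by exists a, false; split => //; rewrite bba !addr0.
move=> [k [s [jk ->]]]; rewrite addr0.
move: (jk); rewrite -val_eqE /= neq_ltn => /orP[lt|lt].
  exists j, k; split => //; left; split => //; rewrite /base lt.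
  by case: s; rewrite /= ?addr0; [left|right].
exists k, j; split => //; right; split => //; rewrite baseC /base lt.
by case: s; rewrite /= ?addr0; [left|right].
Qed.

Lemma vertexP v : vertex v <-> exists j sj k sk, corner v j sj k sk.
Proof.
split.
  move=> [a [b [ab]]] /=; have abn : a != b by rewrite -val_eqE neq_ltn ab.
  have bab : base a b = pos T a b by rewrite /base ab.
  case=> ->; [exists a, true, b, true|exists a, false, b, true
             |exists a, true, b, false|exists a, false, b, false];
    by split => //; rewrite /= bab ?addr0.
move=> [j [sj [k [sk c]]]].
wlog lt : j sj k sk c / (j < k)%N.
  move=> H; have [jk _] := c.
  move: (jk); rewrite -val_eqE /= neq_ltn => /orP[|lt]; first exact: H c.
  exact: H (corner_sym c) lt.
have [jk ->] := c; exists j, k; split => //=; rewrite /base lt.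
by case: sj {c}; case: sk; rewrite /= ?addr0;
  [constructor 1|constructor 3|constructor 2|constructor 4].
Qed.

Lemma vert_ind (f : plane R -> R) (Q : plane R -> Prop) :
  (forall v, vertex v -> (forall v', vertex v' -> f v' < f v -> Q v') -> Q v) ->
  forall v, vertex v -> Q v.
Proof.
move=> H v /vertexP[j [sj [k [sk c]]]].
pose pt (i : 'I_n * bool * ('I_n * bool)) : plane R :=
  base i.1.1 i.2.1 + off i.1.2 i.1.1 + off i.2.2 i.2.1.
have vpt w a sa b sb : corner w a sa b sb -> w = pt (a, sa, (b, sb)) by case.
suff : forall i, vertex (pt i) -> Q (pt i).
  by move=> /(_ (j, sj, (k, sk))); rewrite -(vpt _ _ _ _ _ c); apply; apply/vertexP;
     exists j, sj, k, sk.
apply: (@fin_ind R _ (fun i => f (pt i))) => i IH vi.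
apply: H => // v' /[dup] vv' /vertexP[a [sa [b [sb c']]]] lt.
by rewrite (vpt _ _ _ _ _ c'); apply: IH; rewrite -(vpt _ _ _ _ _ c').
Qed.

Lemma edge_vertex u j : edge u j -> vertex u.
Proof. by move=> /edgeP[k [s c]]; apply/vertexP; exists j, true, k, s. Qed.

Lemma edge_vertex' u j : edge u j -> vertex (u + e j).
Proof.
move=> /edgeP[k [s c]]; apply/vertexP; exists j, false, k, s.
exact: (corner_move c).
Qed.

Lemma vertex_polygon v : vertex v -> polygon v.
Proof. by move=> /vertexP[j [sj [k [sk /corner_polygon]]]]. Qed.

(** To the left of a side there is room for a tile, unless [cr (e j)] is maximal there,
    and then the side is one of the polygon. *)
Lemma edge_pos u j : edge u j ->
  u = tail j.+1 \/ exists k s, corner u j true k s /\ 0 < cr (e j) (dir s k).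
Proof.
move=> /edgeP[k [s c]]; have [jk _] := c.
have := cr_dir_neq0 R s jk; rewrite neq_lt => /orP[neg|pos]; last first.
  by right; exists k, s.
case: (ltP (cr (e j) u) (cr (e j) (tail j.+1))) => [lt|ge]; last first.
  left; apply: poly_side_edge ge; first exact: corner_polygon c.
  exact: corner_polygon (corner_move c).
right; have dpos : 0 < cr (e j) (tail j.+1 - u) by rewrite crDr crNr subr_gt0.
have [||k' [s' [c' side]]] := edge_match (d := tail j.+1 - u) c.
- by rewrite addrC subrK; apply: tail_poly.
- by rewrite nmulr_rlt0.
by exists k', s'; split => //; rewrite pmulr_lgt0 in side.
Qed.

Lemma exists_other j : exists k, j != k.
Proof.
case: (eqVneq j (first_ord n_ge2)) => [->|]; last by exists (first_ord n_ge2).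
by exists (last_ord n_ge2); rewrite -val_eqE /= subn1; lia.
Qed.

(** Start from any tile with a side [e j] and follow the strip to the left: it can only
    stop at the boundary. *)
Lemma tail_edge j : edge (tail j.+1) j.
Proof.
have [k jk] := exists_other j.
have E : edge (base j k) j by apply/edgeP; exists k, true; split; rewrite //= !addr0.
move: (E); apply: (@vert_ind (fun v => - cr (e j) v) (fun v => edge v j -> edge (tail j.+1) j));
  last exact: edge_vertex E.
move=> v vv IH Ev; have [<- //|[k' [s' [c side]]]] := edge_pos Ev.
have c' := corner_sym (corner_move (corner_sym c)).
have E' : edge (v + dir s' k') j by apply/edgeP; exists k', (~~ s').
by apply: (IH _ _ _ E'); [apply: edge_vertex E' | rewrite crDr ltrN2 ltrDl].
Qed.

End Graph.

Section Walks.
Variables (R : realType) (n : nat) (n_ge2 : (2 <= n)%N) (T : tiling R n).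
Implicit Types (i j k a b : 'I_n) (u v x d : plane R) (s : bool) (l : seq 'I_n).
Local Notation e := (@e R n).
Local Notation cco := (@cco R n).
Local Notation dir := (@dir R n).
Local Notation off := (@off R n).
Local Notation polygon := (@polygon R n).
Local Notation base := (base T).
Local Notation corner := (corner T).
Local Notation open_tile := (open_tile T).
Local Notation tail := (@tail R n).
Local Notation height := (@height R n n_ge2).
Local Notation edge := (tiling_edge T).
Local Notation vertex := (vertex T).

Lemma corner_up v j k sk : corner v j true k sk -> edge v j.
Proof. by move=> c; apply/edgeP; exists k, sk. Qed.

Lemma corner_down v j k sk : corner v j false k sk -> edge (v - e j) j.
Proof. by move=> /corner_edge c; apply/edgeP; exists k, sk. Qed.

Lemma cr_dir_sgn j k s : j != k ->
  (0 < cr (e j) (dir s k)) = (if s then (j < k)%N else (k < j)%N).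
Proof.
move=> jk; case: s => /=; first exact: cr_e_sgn.
by rewrite crNr -crC cr_e_sgn // eq_sym.
Qed.

Lemma tail_down m : (m < n)%N -> exists i, edge (tail m - e i) i.
Proof.
by move=> mn; exists (Ordinal mn); rewrite (tailS R (Ordinal mn)) addrK; apply: tail_edge.
Qed.

(** Turn to the left around [v] from tile to tile. As long as both sides of the tile go
    up, the larger of their indices increases. This can only stop at the
    left boundary, whose sides are known. *)
Lemma down_edge v : vertex v -> v = 0 \/ exists i, edge (v - e i) i.
Proof.
suff rot m j k : (n - k <= m)%N -> (j < k)%N -> corner v j true k true ->
    v = 0 \/ exists i, edge (v - e i) i.
  move=> /vertexP[j [sj [k [sk c]]]]; case: sj c => [c|/corner_down]; last by right; exists j.
  case: sk c => [c|/corner_sym/corner_down]; last by right; exists k.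
  have [jk _] := c; move: (jk); rewrite -val_eqE /= neq_ltn => /orP[lt|lt].
    exact: (rot _ j k (leqnn _) lt).
  exact: (rot _ k j (leqnn _) lt (corner_sym c)).
elim: m j k => [|m IH] j k; first by rewrite leqn0 subn_eq0 leqNgt ltn_ord.
move=> km jk c; have [->|[i [s [c' pos]]]] := edge_pos n_ge2 (corner_up (corner_sym c)).
  have := ltn_ord k; rewrite leq_eqVlt => /orP[/eqP ->|/tail_down]; last by right.
  by left; rewrite tail_n.
have [ki _] := c'; rewrite cr_dir_sgn // in pos.
case: s c' pos => [c' pos|/corner_sym/corner_down]; last by right; exists i.
by apply: (IH _ _ _ pos c'); move: pos => /=; lia.
Qed.

(** Turn around [v] the other way, starting between two sides that go down: the smaller of
    their indices decreases, and again the turn only stops at the left boundary. *)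
Lemma up_edge v : vertex v -> v = tail 0 \/ exists i, edge v i.
Proof.
suff rot m j k : j = m :> nat -> (j < k)%N -> corner v j false k false ->
    v = tail 0 \/ exists i, edge v i.
  move=> /vertexP[j [sj [k [sk c]]]]; case: sj c => [/corner_up|c]; first by right; exists j.
  case: sk c => [/corner_sym/corner_up|c]; first by right; exists k.
  have [jk _] := c; move: (jk); rewrite -val_eqE /= neq_ltn => /orP[lt|lt].
    exact: (rot _ j k erefl lt).
  exact: (rot _ k j erefl lt (corner_sym c)).
elim/ltn_ind: m j k => m IH j k jm jk c.
have [h|[i [s [c' pos]]]] := edge_pos n_ge2 (corner_down c).
  have vj : v = tail j by rewrite -(subrK (e j) v) h -tailS.
  case: m {IH} jm => [jm|m jm]; first by left; rewrite vj jm.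
  right; have mn : (m < n)%N by apply: leq_trans (ltn_ord j); rewrite jm ltnW.
  by exists (Ordinal mn); rewrite vj jm; apply: (tail_edge n_ge2 T (Ordinal mn)).
have [ji _] := c'; rewrite cr_dir_sgn // in pos.
have := corner_move c'; rewrite /= subrK => /corner_sym.
case: s c' pos => _ pos; first by move/corner_up; right; exists i.
by apply: (IH _ _ _ _ erefl); rewrite -?jm //.
Qed.

(** Otherwise a germ along the side would lie inside both tiles. *)
Lemma no_stab v j sj k sk a : corner v j sj k sk -> edge (v - e a) a ->
  0 < cco sj j k (- e a) -> 0 < cco sk k j (- e a) -> False.
Proof.
move=> c /edgeP[k' [s' c0]] h1 h2; have [jk _] := c.
have kj : k != j by rewrite eq_sym.
have := corner_move c0; rewrite /= subrK => c'.
have [ak' _] := c'; have k'a : k' != a by rewrite eq_sym.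
have H1 : for_small (fun z => open_tile j k (germ v (- e a) (dir s' k') z)).
  by apply: (germ_corner c); apply: lexpos1.
have H2 : for_small (fun z => open_tile a k' (germ v (- e a) (dir s' k') z)).
  apply: (germ_corner c'); rewrite -[- e a]/(dir false a).
    by apply: lexpos1; rewrite cco_dir.
  by apply: lexpos2; rewrite ?cco_dir_other // cco_dir.
have [z _ [z1 z2]] := small_ex (small_and H1 H2).
have [[E _]|[_ E]] := open_tile_uniq jk ak' z1 z2.
  by move: h2; rewrite -E -[- e j]/(dir false j) cco_dir_other ltxx.
by move: h1; rewrite -E -[- e k]/(dir false k) cco_dir_other ltxx.
Qed.

(** The tile to the left of the side [e b] below [v] has its other side at [v] between
    [- e a] and [- e b], by [no_stab], and hence going down. *)
Lemma diamond v a b : edge (v - e a) a -> edge (v - e b) b -> (a < b)%N ->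
  exists k, [/\ (a <= k)%N, (k < b)%N & corner v k false b false].
Proof.
move=> Ea Eb ab; have crab := cr_e_gt0 R ab.
have crba : 0 < cr (e b) (- e a) by rewrite crNr -crC.
have [h|[k [s [c pos]]]] := edge_pos n_ge2 Eb.
  have pa := vertex_polygon (edge_vertex Ea).
  have va : v - e a = tail b.+1 + e b - e a by rewrite -h subrK.
  have cra : cr (e b) (v - e a) = cr (e b) (tail b.+1) + cr (e b) (- e a).
    by rewrite va !crDr crvv addr0.
  have [|t _ ht] := poly_side pa (j := b); first by rewrite cra lerDl ltW.
  move: cra; rewrite ht crDr crZr crvv mulr0 => /addrI /esym h0.
  by rewrite h0 ltxx in crba.
have := corner_move c; rewrite /= subrK => {}c.
have [bk _] := c; have kb : k != b by rewrite eq_sym.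
have X0 : 0 < cco s k b (- e a).
  by move: crba; rewrite (cr_cco s _ bk) pmulr_lgt0.
have Y0 : cco false b k (- e a) <= 0.
  by rewrite leNgt; apply/negP => Y0; apply: no_stab c Ea Y0 X0.
have := cco_decomp false s (- e a) bk.
move: (cco s k b _) (cco false b k _) X0 Y0 => X Y X0 Y0 dec.
rewrite cr_dir_sgn // in pos.
case: s c dec pos => c dec lt.
  have := congr1 height dec.
  rewrite heightN heightD !heightZ /= heightN.
  have := height_e R n_ge2 a; have := height_e R n_ge2 b; have := height_e R n_ge2 k.
  move=> hk hb ha; have := mulr_gt0 X0 hk.
  have : Y * height (e b) <= 0 by rewrite mulr_le0_ge0 // ltW.
  lra.
exists k; split => //; last exact: corner_sym.
rewrite leqNgt; apply/negP => ka.
have := congr1 (cr (e a)) dec.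
rewrite crDr !crZr /= !crNr crvv (crC (e k) (e a)) opprK oppr0.
have := mulr_gt0 X0 (cr_e_gt0 R ka).
have : Y * cr (e a) (e b) <= 0 by rewrite mulr_le0_ge0 // ltW.
lra.
Qed.

(** Walks from the origin along sides, all of them upwards, last step first. *)
Fixpoint upwalk l v : Prop :=
  if l is i :: l' then edge (v - e i) i /\ upwalk l' (v - e i) else v = 0.

Lemma upwalk_cons l v i : upwalk l v -> edge v i -> upwalk (i :: l) (v + e i).
Proof. by move=> h E; rewrite /= addrK. Qed.

Lemma height_polygon v : polygon v -> 0 <= height v.
Proof.
move=> /poly_coefs[a a01 ->].
rewrite (big_morph height (heightD n_ge2) (height0 R n_ge2)).
apply: sumr_ge0 => i _; rewrite heightZ mulr_ge0 //; last exact/ltW/height_e.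
by case/andP: (a01 i).
Qed.

Lemma height_down v i : height (v - e i) < height v.
Proof. by rewrite heightD heightN gtrDl oppr_lt0 height_e. Qed.

Lemma upwalk_exists v : vertex v -> exists l, upwalk l v.
Proof.
move: v; apply: (@vert_ind R n T height) => v vv IH.
have [->|[i E]] := down_edge vv; first by exists [::].
have [l h] := IH _ (edge_vertex E) (height_down v i).
by exists (i :: l).
Qed.

Lemma upwalk_nil l : upwalk l 0 -> l = [::].
Proof.
case: l => // i l [/edge_vertex/vertex_polygon/height_polygon].
by rewrite leNgt -[X in _ < X](height0 R n_ge2) height_down.
Qed.

(** Newman's argument: by [diamond], two last steps [a] and [b] are linked by a chain
    of tiles with top [v], and around each tile the two ways down use the same steps. *)
Lemma upwalk_perm v : vertex v ->
  forall l l', upwalk l v -> upwalk l' v -> perm_eq l l'.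
Proof.
move: v; apply: (@vert_ind R n T height) => v vv IH l l'.
case: l => [/= -> /upwalk_nil -> //|a l].
case: l' => [h /= v0|b l']; first by rewrite v0 in h; rewrite (upwalk_nil h).
(* The chain of tiles is followed by induction on the difference of the indices. *)
have key m a1 b1 l1 l2 : (a1 <= b1)%N -> (b1 - a1 <= m)%N ->
    upwalk (a1 :: l1) v -> upwalk (b1 :: l2) v -> perm_eq (a1 :: l1) (b1 :: l2).
  elim: m a1 b1 l1 l2 => [|m IHm] a1 b1 l1 l2 le dist [Ea ha] [Eb hb].
    have E : a1 = b1 by apply: val_inj; move: dist le => /=; lia.
    rewrite -E in hb *; rewrite perm_cons.
    exact: IH (edge_vertex Ea) (height_down v a1) _ _ ha hb.
  move: le; rewrite leq_eqVlt => /orP[/eqP/val_inj E|ab].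
    rewrite -E in hb *; rewrite perm_cons.
    exact: IH (edge_vertex Ea) (height_down v a1) _ _ ha hb.
  have [k [ak kb c]] := diamond Ea Eb ab.
  have Ek := corner_down c.
  have ck := corner_edge c; have cb := corner_edge (corner_sym c).
  have Ebk := corner_down (corner_sym ck); have Ekb := corner_down (corner_sym cb).
  rewrite /= in Ebk Ekb.
  have [w hw] := upwalk_exists (edge_vertex Ekb).
  have Hk : upwalk (k :: w) (v - e b1) by [].
  have Hb : upwalk (b1 :: w) (v - e k) by split => //; rewrite addrAC.
  have p2 := IH _ (edge_vertex Eb) (height_down v b1) _ _ Hk hb.
  have p1 : perm_eq (a1 :: l1) (k :: b1 :: w).
    by apply: IHm => //; lia.
  apply: perm_trans p1 _; rewrite (perm_catCA [:: k] [:: b1] w) /=.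
  by rewrite perm_cons.
case: (leqP a b) => [le|/ltnW le] h h'; first exact: key le (leqnn _) h h'.
by rewrite perm_sym; apply: key le (leqnn _) h' h.
Qed.

(** The walk along the left boundary. *)
Lemma upwalk_tail m : (m <= n)%N ->
  exists l, [/\ upwalk l (tail m), uniq l & all (fun i : 'I_n => m <= i)%N l].
Proof.
move=> mn; have -> : m = (n - (n - m))%N by lia.
elim: (n - m)%N (leq_subr m n) => [|q IH] qn {mn m}.
  by exists [::]; split => //; rewrite subn0 /= tail_n.
have [l [h u al]] := IH (ltnW qn).
have mn : (n - q.+1 < n)%N by lia.
pose i := Ordinal mn; have iE : (n - q)%N = i.+1 by rewrite /=; lia.
have ti : tail (n - q.+1) = tail (n - q) + e i by rewrite iE -tailS.
exists (i :: l); split.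
- by rewrite ti; apply: upwalk_cons h _; rewrite iE; apply: tail_edge.
- rewrite /= u andbT; apply/negP => /(allP al); rewrite iE ltnn //.
- by rewrite /= leqnn; apply: sub_all al => k /=; lia.
Qed.

(** Every upward walk extends to the top of the polygon, where it must use the same steps
    as the left boundary. *)
Lemma upwalk_uniq v : vertex v -> forall l, upwalk l v -> uniq l.
Proof.
move: v; apply: (@vert_ind R n T (fun v => - height v)) => v vv IH l h.
have [v0|[i E]] := up_edge vv.
  have [l' [h' u _]] := upwalk_tail (leq0n n).
  by rewrite -v0 in h'; rewrite (perm_uniq (upwalk_perm vv h h')).
have lt : - height (v + e i) < - height v by rewrite ltrN2 heightD ltrDl height_e.
by have /= /andP[] := IH _ (edge_vertex' E) lt _ (upwalk_cons h E).
Qed.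

End Walks.

Section Labels.
Variables (R : realType) (n : nat) (n_ge2 : (2 <= n)%N) (T : tiling R n).
Implicit Types (i j k q : 'I_n) (w : seq ('I_n * bool)) (u v : plane R) (s : bool) (l : seq 'I_n).
Local Notation e := (@e R n).
Local Notation dir := (@dir R n).
Local Notation off := (@off R n).
Local Notation base := (base T).
Local Notation corner := (corner T).
Local Notation tail := (@tail R n).
Local Notation edge := (tiling_edge T).
Local Notation vertex := (vertex T).
Local Notation label := (label T).
Local Notation upwalk := (upwalk T).

Lemma walk_rcons u w v i : walk T u w v -> edge v i -> walk T u (rcons w (i, true)) (v + e i).
Proof.
elim: w u => [u <- //|[j []] w IH] u /= [E h] Ei; split => //; exact: IH.
Qed.

Lemma upwalk_walk l v : upwalk l v -> walk T 0 (rev [seq (i, true) | i <- l]) v.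
Proof.
elim: l v => [v ->//|i l IH] v [E h] /=.
by rewrite rev_cons -[X in walk _ _ _ X](subrK (e i) v); apply: walk_rcons E; apply: IH.
Qed.

(** Each step, in either direction, changes the steps of the upward walks to the current
    vertex by one element, as these do not depend on the walk. *)
Lemma walk_count w u v lu : walk T u w v -> vertex u -> upwalk lu u ->
  exists2 lv, upwalk lv v & forall i,
    (count_mem i lv + count_mem (i, false) w = count_mem i lu + count_mem (i, true) w)%N.
Proof.
elim: w u lu => [|[j b] w IH] u lu /=.
  by move=> <- _ h; exists lu.
case: b => -[E h] vu hu.
  have [lv hv cnt] := IH _ _ h (edge_vertex' E) (upwalk_cons hu E).
  exists lv => // i; have := cnt i; rewrite /= !xpair_eqE andbF andbT.
  by case: (j == i); rewrite /=; lia.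
have [l1 h1] := upwalk_exists n_ge2 (edge_vertex E).
have h1' : upwalk (j :: l1) u by [].
have [lv hv cnt] := IH _ _ h (edge_vertex E) h1.
exists lv => // i; have := cnt i; rewrite (seq.permP (upwalk_perm n_ge2 vu hu h1')) /=.
by rewrite !xpair_eqE andbF andbT; case: (j == i); rewrite /=; lia.
Qed.

Lemma count_sum (I : finType) (l : seq I) : (size l = \sum_i count_mem i l)%N.
Proof.
elim: l => [|a l IH] /=; first by rewrite big1.
rewrite big_split /= -IH (bigD1 a) //= eqxx big1 ?addn0 //.
by move=> i /negPf; rewrite eq_sym => ->.
Qed.

Lemma size_walk_sum w :
  (size w = \sum_(i < n) (count_mem (i, true) w + count_mem (i, false) w))%N.
Proof.
rewrite count_sum; transitivity (\sum_(x : 'I_n * bool) count_mem (x.1, x.2) w)%N.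
  by apply: eq_bigr => -[].
rewrite -(pair_bigA _ (fun i b => count_mem (i, b) w)) /=.
by apply: eq_bigr => i _; rewrite big_bool.
Qed.

(** By [walk_count] a walk to [v] has at least as many steps as an upward one, with
    equality only if it has no step backwards. *)
Lemma label_upwalk l v : vertex v -> upwalk l v -> label v = [set i in l].
Proof.
move=> vv h; apply/setP => i; rewrite !inE.
have walk_cnt w : walk T 0 w v -> forall i,
    (count_mem i l + count_mem (i, false) w = count_mem (i, true) w)%N.
  move=> hw k.
  have [l0 h0] : exists l0, upwalk l0 (0 : plane R) by exists [::].
  have v0 : vertex 0.
    have [k0 _] := exists_other n_ge2 (first_ord n_ge2).
    have := tail_edge n_ge2 T (last_ord n_ge2).
    have -> : (nat_of_ord (last_ord n_ge2)).+1 = n by rewrite /= subn1; lia.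
    by rewrite tail_n => /edge_vertex.
  have h0' : upwalk [::] (0 : plane R) by [].
  have [lv hv cnt] := walk_count hw v0 h0'.
  by rewrite (seq.permP (upwalk_perm n_ge2 vv h hv)) cnt.
have up_size : size (rev [seq (j, true) | j <- l]) = size l by rewrite size_rev size_map.
apply/asboolP/idP => [[w [[hw short] iw]]|il].
  have cnt := walk_cnt w hw.
  have := short _ (upwalk_walk h); rewrite up_size size_walk_sum count_sum => le.
  have f0 : (\sum_i count_mem (i, false) w = 0)%N.
    have : (\sum_(j < n) (count_mem (j, true) w + count_mem (j, false) w) =
            \sum_j count_mem j l + (\sum_(j < n) count_mem (j, false) w).*2)%N.
      rewrite -addnn -!big_split /=; by apply: eq_bigr => j _; rewrite -(cnt j) /= addnA.
    by move=> E; move: le; rewrite E -[X in (_ <= X)%N]addn0 leq_add2l leqn0 double_eq0 => /eqP.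
  have := cnt i; move/eqP: f0; rewrite sum_nat_eq0 => /forallP/(_ i)/eqP -> .
  rewrite addn0 => E; rewrite -has_pred1 has_count E -has_count has_pred1 //.
exists (rev [seq (j, true) | j <- l]); split; last first.
  by rewrite mem_rev; apply/mapP; exists i.
split=> [|w hw]; first exact: upwalk_walk.
rewrite up_size size_walk_sum count_sum; apply: leq_sum => j _.
by rewrite -(walk_cnt w hw j) -addnA leq_addr.
Qed.

Lemma label_edge u i : edge u i -> i \notin label u /\ label (u + e i) = i |: label u.
Proof.
move=> E; have [l h] := upwalk_exists n_ge2 (edge_vertex E).
have h' := upwalk_cons h E.
have := upwalk_uniq n_ge2 (edge_vertex' E) h'; rewrite /= => /andP[il _].
rewrite (label_upwalk (edge_vertex E) h) (label_upwalk (edge_vertex' E) h') inE il.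
by split => //; apply/setP => j; rewrite !inE.
Qed.

(** * Strips of tiles *)

Section Strip.
Variable q : 'I_n.

(** One step to the left along the strip of tiles with sides [e q]. *)
Definition strip_step u k u' :=
  exists s, [/\ corner u q true k s, 0 < cr (e q) (dir s k) & u' = u + dir s k].

(** The side [u], [u + e q] is [m] tiles before the end of its strip. *)
Fixpoint strip_rank m u : Prop :=
  if m is m'.+1 then exists k u', strip_step u k u' /\ strip_rank m' u'
  else u = tail q.+1.

Lemma strip_rank_exists u : edge u q -> exists m, strip_rank m u.
Proof.
move=> E; move: (E); have := edge_vertex E; move: u {E}.
apply: (@vert_ind R n T (fun v => - cr (e q) v)) => u vu IH E.
have [->|[k [s [c pos]]]] := edge_pos n_ge2 E; first by exists 0%N.
have c' := corner_sym (corner_move (corner_sym c)).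
have E' := corner_up c'.
have [|m hm] := IH _ (edge_vertex E') _ E'; first by rewrite crDr ltrN2 ltrDl.
by exists m.+1, k, (u + dir s k); split => //; exists s.
Qed.

Lemma strip_step_inj u k u' u2 k' : strip_step u k u' -> strip_step u2 k' u' -> u = u2.
Proof.
move=> [s [c pos uu']] [s' [c' pos' u2u']].
have := corner_sym (corner_move (corner_sym c)); rewrite -uu' => d.
have := corner_sym (corner_move (corner_sym c')); rewrite -u2u' => d'.
have same : 0 < cr (e q) (dir (~~ s) k) * cr (e q) (dir (~~ s') k').
  by rewrite !dirN !crNr mulrNN mulr_gt0.
have uu : u' = u' + 0 *: e q by rewrite scale0r addr0.
have t01 : 0 <= (0 : R) < 1 by rewrite lexx ltr01.
have [kk' /negb_inj ss' _] := edge_overlap d d' same uu t01.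
by move: u2u'; rewrite -kk' -ss' uu' => /addIr.
Qed.

Lemma strip_step_det u k u' k' u2 : strip_step u k u' -> strip_step u k' u2 ->
  k = k' /\ u' = u2.
Proof.
move=> [s [c pos ->]] [s' [c' pos' ->]].
have uu : u = u + 0 *: e q by rewrite scale0r addr0.
have t01 : 0 <= (0 : R) < 1 by rewrite lexx ltr01.
by have [-> -> _] := edge_overlap c c' (mulr_gt0 pos pos') uu t01.
Qed.

(** All strips with sides [e q] end at the same side of the polygon, and they can be
    followed backwards in one way only; so there is one strip. *)
Lemma strip_rank_inj m u u' : strip_rank m u -> strip_rank m u' -> u = u'.
Proof.
elim: m u u' => [|m IH] u u' /=; first by move=> -> ->.
move=> [k [v [st r]]] [k' [v' [st' r']]].
by move: st'; rewrite -(IH _ _ r r') => st'; apply: strip_step_inj st st'.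
Qed.

Lemma strip_step_label u k u' : strip_step u k u' ->
  [/\ q != k, k \in label u = (k < q)%N, k \in label u' = (q < k)%N &
      forall i, i != k -> (i \in label u) = (i \in label u')].
Proof.
move=> [s [c pos ->]]; have [qk _] := c; rewrite cr_dir_sgn // in pos.
case: s c pos => c lt.
  have [h1 h2] := label_edge (corner_up (corner_sym c)).
  split => //.
  - by rewrite (negPf h1) ltnNge ltnW.
  - by rewrite /= h2 !inE eqxx lt.
  - by move=> i /negPf ik; rewrite /= h2 !inE ik.
have := label_edge (corner_down (corner_sym c)); rewrite subrK => -[h1 h2].
split => //.
- by rewrite h2 !inE eqxx lt.
- by rewrite /= (negPf h1) ltnNge ltnW.
- by move=> i /negPf ik; rewrite h2 !inE ik.
Qed.

(** To the left, indices above [q] enter the label and indices below [q] leave it; each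
    does so for good. *)
Lemma strip_label_mono m d u u' : strip_rank (d + m) u -> strip_rank m u' ->
  forall i, i != q -> (q < i)%N = (i \in label u) -> (i \in label u) = (i \in label u').
Proof.
elim: d u => [|d IH] u; first by move=> h h'; rewrite (strip_rank_inj h h').
move=> [k [v [st r]]] r' i iq Ei.
have [qk ku kv other] := strip_step_label st.
case: (eqVneq i k) => [ik|ik].
  by move: Ei; rewrite ik ku; case: ltngtP qk => // /val_inj ->; rewrite eqxx.
by rewrite other // in Ei *; exact: (IH _ r r' i iq Ei).
Qed.

(** The side [e q] of the tile of [q] and [k] from which the strip enters it. *)
Definition entry k : plane R := base q k + off (q < k)%N k.

Lemma entry_corner k : q != k -> corner (entry k) q true k (q < k)%N.
Proof. by move=> qk; split; rewrite // addr0. Qed.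

Lemma entry_step k : q != k -> strip_step (entry k) k (entry k + dir (q < k)%N k).
Proof.
move=> qk; exists (q < k)%N; split => //; first exact: entry_corner.
by rewrite cr_dir_sgn //; move: qk; rewrite -val_eqE /=; case: ltngtP.
Qed.

Lemma entry_label k i : q != k -> i != k -> (i \in label (entry k)) = (i \in label (base q k)).
Proof.
move=> qk /negPf ik; rewrite /entry; case: ltnP => _; first by rewrite /off addr0.
have c : corner (base q k) k true q true by split; rewrite 1?eq_sym // baseC /off !addr0.
by have [_ ->] := label_edge (corner_up c); rewrite !inE ik.
Qed.

Lemma entry_order i k mi mk : q != i -> q != k -> i != k ->
  strip_rank mi (entry i) -> strip_rank mk (entry k) ->
  mi != mk /\ (i \in label (base q k)) = ((q < i) == (mk < mi))%N.
Proof.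
move=> qi qk ik ri rk; have iq : i != q by rewrite eq_sym.
have mik : mi != mk.
  apply/eqP => E; rewrite E in ri; have E' := strip_rank_inj ri rk.
  have := entry_step qi; rewrite E' => /strip_step_det /(_ (entry_step qk)) [E'' _].
  by rewrite E'' eqxx in ik.
split => //; rewrite -entry_label //.
have [_ iu iv _] := strip_step_label (entry_step qi).
case: (ltnP mk mi) => [lt|]; last rewrite leq_eqVlt (negPf mik) /= => lt.
  have mi_gt0 : (0 < mi)%N by apply: leq_ltn_trans lt.
  move: ri lt; rewrite -(prednK mi_gt0) => -[i' [v [st r]]] lt.
  have [Ei Ev] := strip_step_det (entry_step qi) st.
  rewrite -Ev in r; rewrite ltnS in lt; rewrite -(subnK lt) in r.
  by rewrite -(strip_label_mono r rk iq) iv // eqb_id.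
have qiN : (i < q)%N = ~~ (q < i)%N by move: iq; rewrite -val_eqE /=; case: ltngtP.
rewrite eqbF_neg; apply/idP/idP => h; last first.
  apply/negPn/negP => /negPf h'; have E : (q < i)%N = (i \in label (entry k)) by rewrite h' (negPf h).
  rewrite -(subnK (ltnW lt)) in rk.
  by have := strip_label_mono rk ri iq E; rewrite iu h' qiN h.
apply/negP => h'; have E : (q < i)%N = (i \in label (entry k)) by rewrite h h'.
rewrite -(subnK (ltnW lt)) in rk.
by have := strip_label_mono rk ri iq E; rewrite iu h qiN h'.
Qed.
End Strip.

(** [r q k] is the number of steps from the tile of [q] and [k] to the end of the strip
    of [q]. *)
Lemma label_order : exists r : 'I_n -> 'I_n -> nat, 
  (forall q i k, q != i -> q != k -> i != k -> r q i != r q k) /\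
  (forall q i k, q != i -> q != k -> i != k ->
     (i \in label (base q k)) = ((q < i) == (r q k < r q i))%N).
Proof.
have ex (qk : 'I_n * 'I_n) : exists m, qk.1 != qk.2 -> strip_rank qk.1 m (entry qk.1 qk.2).
  case: qk => q k /=; case: (eqVneq q k) => [_|qk]; first by exists 0%N.
  by have [m h] := strip_rank_exists (corner_up (entry_corner qk)); exists m.
have [r hr] := choice ex; exists (fun q k => r (q, k)).
by split => q i k qi qk ik; have [] := entry_order qi qk ik (hr (q, i) qi) (hr (q, k) qk).
Qed.

End Labels.

(** * Networks of matrices *)

Section LabelsOfTiles.
Variables (R : realType) (n : nat) (n_ge2 : (2 <= n)%N) (T : tiling R n).
Implicit Types (j k q : 'I_n).
Local Notation e := (@e R n).
Local Notation label := (label T).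

Lemma base_corner j k : j != k -> corner T (base T j k) j true k true.
Proof. by move=> jk; split; rewrite // !addr0. Qed.

Lemma tile_labels j k : j != k -> let t := base T j k in let S := label t in
  [/\ j \notin S, k \notin S, label (t + e j) = j |: S, label (t + e k) = k |: S &
      label (t + e j + e k) = j |: (k |: S)].
Proof.
move=> jk t S; have c := base_corner jk; have c' := corner_sym c.
have [jS lj] := label_edge n_ge2 (corner_up c).
have [kS lk] := label_edge n_ge2 (corner_up c').
have [_ ljk] := label_edge n_ge2 (corner_up (corner_sym (corner_move c'))).
split => //; rewrite addrAC ljk -/t /=.
by rewrite lk.
Qed.

Lemma tile_vertices j k : j != k -> let t := base T j k in
  [/\ vertex T t, vertex T (t + e j), vertex T (t + e k) & vertex T (t + e j + e k)].
Proof.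
move=> jk t; have c := base_corner jk; have c' := corner_sym c.
have E := corner_up c; have E' := corner_up c'; have E'' := corner_up (corner_sym (corner_move c')).
split; [exact: edge_vertex E|exact: edge_vertex' E|exact: edge_vertex' E'|].
by rewrite addrAC; apply: edge_vertex' E''.
Qed.

(** The two strips through a tile give it the same label, so that the tiling defines
    consistent orders on its strips. *)
Lemma tile_label_face : exists2 r, strip_orders r &
  forall j k, j != k -> label (base T j k) = face r j k.
Proof.
have [r [inj lab]] := label_order n_ge2 T; exists r.
  split => [x a b xa xb ab|l x y lx ly xy]; first exact: inj.
  have yx : y != x by rewrite eq_sym.
  have [xl yl] : x != l /\ y != l by rewrite !(eq_sym _ l).
  by rewrite /above -lab // -lab // baseC.
move=> j k jk; apply/setP => l; rewrite [RHS]inE.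
have [jS kS _ _ _] := tile_labels jk.
case: (eqVneq l j) => [->|lj] /=; first exact: negbTE jS.
case: (eqVneq l k) => [->|lk] /=; first exact: negbTE kS.
by rewrite lab // eq_sym.
Qed.
End LabelsOfTiles.

Section Main.
Variables (R : realType) (n : nat) (n_ge2 : (2 <= n)%N).
Variables (K : numFieldType) (c : {rmorphism K -> K}).
Hypothesis cK : involutive c.
Hypothesis c_real : forall x, x \is Num.real -> c x = x.
Hypothesis c_norm : forall x, x * c x = `|x| ^+ 2.
Implicit Types (A : 'M[K]_n) (S : {set 'I_n}) (j k : 'I_n) (T : tiling R n).

Lemma Mstar_pminor A : Mstar A -> forall S, pminor A S != 0.
Proof. by move=> [h _] S; rewrite -minor_principal. Qed.

Lemma sigma_faces S j k : j \notin S -> k \notin S -> j != k ->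
  let s := @sigma n K in
  s S * s (j |: (k |: S)) = -1 /\ s (j |: S) * s (k |: S) = 1.
Proof.
move=> jS kS jk s; have jkS : j \notin k |: S by rewrite !inE negb_or jk.
rewrite /s /sigma !cardsU1 jS kS jkS /= exprS mulrCA.
by rewrite -!expr2 !sqrr_sign mulr1.
Qed.

Lemma odd_apmC S j k : j != k -> odd_apm S j k = false -> odd_apm S k j.
Proof.
rewrite /odd_apm => jk; case: (odd #|S|) (signr_odd int #|S|) => <-.
  rewrite expr1 !mulrN1 !opprB; move: jk; rewrite -val_eqE /=; lia.
rewrite expr0 !mulr1; move: jk; rewrite -val_eqE /=; lia.
Qed.

(** The signs of the network turn the right-hand side of the Hermitian condition into
    that of Sylvester's identity. *)
Lemma hermitian_tile A T j k : (j < k)%N ->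
  let t := pos T j k in let N := minor_network A T in let S := label T t in
  [/\ `|fface N j k| =
       `|if odd_apm S j k then minor A (j |: S) (k |: S) else minor A (k |: S) (j |: S)| &
   fvert N t * fvert N (t + e R j + e R k) + fvert N (t + e R j) * fvert N (t + e R k) =
   pminor A (j |: S) * pminor A (k |: S) - pminor A S * pminor A (j |: (k |: S))].
Proof.
move=> jk; have njk : j != k by rewrite -val_eqE neq_ltn jk.
have tb : pos T j k = base T j k by rewrite /base jk.
move=> t N S; have := tile_labels n_ge2 T njk; rewrite -tb -/t -/S => -[jS kS lj lk ljk].
split; first by rewrite /= normrM normr_sign mul1r.
rewrite /= -/t -/S lj lk ljk !minor_principal.
have [s1 s2] := sigma_faces jS kS njk.
by rewrite mulrACA s1 mulN1r [X in _ + X]mulrACA s2 mul1r addrC.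
Qed.

(** For a Hermitian matrix the two almost-principal minors of a face are conjugate, so
    that the Hermitian condition is Sylvester's identity. *)
Lemma posdef_network A T : Mstar A -> posdef_hermitian c A ->
  net_positive (minor_network A T).
Proof.
move=> ms pd; have Apos := posdef_pminor pd; have [herm _] := pd.
have nz := Mstar_pminor ms.
split; first split.
- move=> v _ /=; rewrite minor_principal.
  by rewrite rpredM ?rpred_sign // gtr0_real.
- move=> j k jk t; have njk : j != k by rewrite -val_eqE neq_ltn jk.
  have [-> ->] := hermitian_tile A T jk.
  have tb : pos T j k = base T j k by rewrite /base jk.
  have := tile_labels n_ge2 T njk; rewrite -tb -/t; set S := label T t => -[jS kS _ _ _].
  rewrite -minor_sylvester // -c_norm.
  have card : #|j |: S| = #|k |: S| by rewrite !cardsU1 jS kS.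
  have swap : minor A (k |: S) (j |: S) = c (minor A (j |: S) (k |: S)).
    by rewrite -{1}herm minor_map minor_tr.
  by case: ifP => _; rewrite swap // cK mulrC.
- move=> v _ /=; rewrite minor_principal.
  rewrite /sigma -signr_odd; case: (odd _).
    by rewrite expr1 mulN1r ltr0_sg // oppr_lt0.
  by rewrite expr0 mul1r gtr0_sg.
Qed.

Lemma sg_sign_pos (x : K) m : x \is Num.real -> Num.sg ((-1) ^+ m * x) = (-1) ^+ m -> 0 < x.
Proof.
move=> xr; rewrite -signr_odd; case: (odd m); rewrite ?expr0 ?expr1 ?mul1r ?mulN1r.
  case: (real_ltgt0P xr) => // [x0|->].
    rewrite gtr0_sg ?oppr_gt0 // => /eqP; rewrite -subr_eq0 opprK gt_eqF ?addr_gt0 ?ltr01 //.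
  by rewrite oppr0 sgr0 => /eqP; rewrite eq_sym oppr_eq0 oner_eq0.
case: (real_ltgt0P xr) => // [x0|->].
  rewrite ltr0_sg // => /eqP; rewrite eq_sym -subr_eq0 opprK gt_eqF ?addr_gt0 ?ltr01 //.
by rewrite sgr0 => /eqP; rewrite eq_sym oner_eq0.
Qed.

(** Sylvester's identity and the Hermitian condition make the odd almost-principal minor
    of a face, which is not 0, conjugate to the even one. *)
Lemma network_posdef (N : network R n K) A : net_positive N -> Mstar A ->
  same_values (minor_network A (net_tiling N)) N -> posdef_hermitian c A.
Proof.
set T := net_tiling N => -[[real herm] sgn] ms [sv sf].
have nz := Mstar_pminor ms.
have ppos v : vertex T v -> 0 < pminor A (label T v).
  move=> vv; have E := sv v vv; rewrite /= in E.
  apply: (@sg_sign_pos _ #|label T v|./2).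
    have := real v vv; rewrite -E minor_principal /sigma => h.
    by rewrite -(signrMK #|label T v|./2 (pminor _ _)) rpredM ?rpred_sign.
  by have := sgn v vv; rewrite -E minor_principal.
have faceP j k : (j < k)%N -> hermitian_face c A (label T (base T j k)) j k.
  move=> jk; have njk : j != k by rewrite -val_eqE neq_ltn jk.
  have tb : base T j k = pos T j k by rewrite /base jk.
  have [v1 v2 v3 v4] := tile_vertices T njk.
  have := tile_labels n_ge2 T njk => -[jS kS lj lk ljk].
  have p1 := ppos _ v1; have p2 := ppos _ v2; have p3 := ppos _ v3; have p4 := ppos _ v4.
  rewrite lj in p2; rewrite lk in p3; rewrite ljk in p4.
  split => //.
  have := herm j k jk; rewrite /= -/T -tb -!sv // -sf //.
  have [h1 h2] := hermitian_tile A T jk; rewrite -tb in h1 h2.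
  rewrite h1 h2 -minor_sylvester // -c_norm.
  have [b [E1 E2]] := minor_schur nz jS kS.
  set S := label T (base T j k) in E1 E2 jS kS p1 *.
  have cp : c (pminor A S) = pminor A S by apply: c_real; apply: gtr0_real.
  have [_ odd_nz] := ms.
  case: ifP => odd.
    have m0 := odd_nz _ _ _ njk jS kS odd.
    move/(mulfI m0); rewrite E1 E2 !rmorphM rmorph_sign cp /=.
    move/(can_inj (signrMK b))/(mulIf (nz S)) => <-.
    by rewrite cK.
  have nkj : k != j by rewrite eq_sym.
  have m0 := odd_nz _ _ _ nkj kS jS (odd_apmC njk odd).
  rewrite [RHS]mulrC.
  move/(mulfI m0); rewrite E1 E2 !rmorphM rmorph_sign cp /=.
  by move/(can_inj (signrMK b))/(mulIf (nz S)) => <-.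
have [r ro lab] := tile_label_face n_ge2 T.
apply: (hermitian_intervals cK c_real c_norm n_ge2 nz).
apply: (sweep_faces (P := hermitian_face c A)) ro _ => [S x y z|j k jk].
  exact: hermitian_cube.
have njk : j != k by rewrite -val_eqE neq_ltn jk.
by rewrite -lab //; apply: faceP.
Qed.

End Main.

Lemma real_or_complex_conj (R : realType) (K : numFieldType) (conj : K -> K) :
  real_or_complex R conj -> exists c : {rmorphism K -> K},
    [/\ conj = c, involutive c, forall x, x \is Num.real -> c x = x &
        forall x, x * c x = `|x| ^+ 2].
Proof.
case=> {K conj}.
  exists idfun; split => // x /=.
  by rewrite -expr2 real_normK // num_real.
exists (@conjc R); split => // [|x xr|x].
- exact: conjcK.
- exact/CrealP.
- by rewrite sqr_normc.
Qed.

Theorem theorem5p7 (R : realType) (n : nat) (n_ge2 : (2 <= n)%N)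
    (K : numFieldType) (conj : K -> K) (hK : real_or_complex R conj) :
  (forall A : 'M[K]_n, Mstar A -> posdef_hermitian conj A ->
     forall T : tiling R n, net_positive (minor_network A T)) /\
  (forall N : network R n K, net_generic N -> net_positive N -> fvert N 0 = 1 ->
     forall A : 'M[K]_n, Mstar A ->
       same_values (minor_network A (net_tiling N)) N ->
       posdef_hermitian conj A).
Proof.
have [c [-> cK c_real c_norm]] := real_or_complex_conj hK; split.
  by move=> A ms pd T; apply: (posdef_network n_ge2 cK c_norm).
move=> N _ pos _ A ms sv; exact: (network_posdef n_ge2 cK c_real c_norm pos ms sv).
Qed.
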